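(* Let $M$ be a smooth manifold and let $\mathfrak s$ be a symmetry jet on $M$. For each $x\in M$ write $\mathfrak s(x)=j^1_xs_x$ with $s_x:U_x\to\mathcal B^{(1)}$ a local bisection defined near $x$. Then the formula $$\bigl(\nabla^{\mathfrak s}_XY\bigr)_x=\tfrac12\bigl[X,\;Y+s_x(Y)\bigr]_x,\qquad X,Y\in\mathfrak X(M),\ x\in M,$$ defines an affine connection on $M$. Moreover, $\mathfrak s\mapsto\nabla^{\mathfrak s}$ is a bijective correspondence between symmetry jets on $M$ and affine connections on $M$.
   Context: All objects are smooth; affine connections may have torsion. $\mathcal B^{(1)}$ is the Lie groupoid over $M$ whose elements are the linear isomorphisms $\xi:T_xM\to T_yM$ ($x,y\in M$), with source $\alpha(\xi)=x$, target $\beta(\xi)=y$ and composition as multiplication. $-I_x\in\mathcal B^{(1)}$ denotes $-\mathrm{id}_{T_xM}$. A local bisection of $\mathcal B^{(1)}$ is a smooth section $b:U\to\mathcal B^{(1)}$ of $\alpha$ over an open set $U\subset M$ such that $b^0:=\beta\circ b$ is a diffeomorphism onto an open subset of $M$. A $(1,1)$-jet is the $1$-jet $j^1_xb$ at a point $x$ of a local bisection $b$ of $\mathcal B^{(1)}$; put $\alpha(j^1_xb)=x$, $p(j^1_xb)=b(x)\in\mathcal B^{(1)}$ and $p_*(j^1_xb)=(b^0)_{*_x}\in\mathcal B^{(1)}$. Let $\mathcal B^{(1,1)}_{sh}$ be the set of (semi-holonomic) $(1,1)$-jets $\eta$ with $p(\eta)=p_*(\eta)$. A symmetry jet is a smooth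 section $\mathfrak s:M\to\mathcal B^{(1,1)}_{sh}$ of $\alpha$ with $p(\mathfrak s(x))=p_*(\mathfrak s(x))=-I_x$ for all $x$. For a local bisection $b$ and a vector field $Y$, $b(Y)$ is the local vector field defined by $b(Y)_{b^0(x')}=b(x')Y_{x'}$. *)

(* Defs.v *)
From HB Require Import structures.
From mathcomp Require Import all_boot all_order all_algebra.
From mathcomp Require Import all_classical all_reals all_analysis.

Set Implicit Arguments.
Unset Strict Implicit.
Unset Printing Implicit Defensive.

Import Order.TTheory GRing.Theory Num.Theory.
Import numFieldNormedType.Exports.

Local Open Scope classical_set_scope.
Local Open Scope ring_scope.

Section Smooth.
Context {R : realType}.
Implicit Types V W : normedModType R.

(* Meant for an open set [D]: differentiability at [z] and the differentials
   involve a full neighbourhood of [z]. *)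
Fixpoint Ck (k : nat) V W (D : set V) (f : V -> W) : Prop :=
  match k with
  | 0 => forall z, D z -> {for z, continuous f}
  | k'.+1 => (forall z, D z -> differentiable f z) /\
             (forall v, Ck k' D (fun z => 'd f z v))
  end.

Definition smooth_on V W (D : set V) (f : V -> W) : Prop := forall k, Ck k D f.

Lemma near_eq_is_diff V W (f g : V -> W) (x : V) :
  (\forall z \near x, f z = g z) -> differentiable f x ->
  differentiable g x /\ 'd g x = 'd f x :> (V -> W).
Proof.
move=> fg df.
have fgx : f x = g x := nbhs_singleton fg.
have key : g \o shift x = cst (g x) + 'd f x +o_ 0 id.
  apply/eqaddoP => e e0.
  have /eqaddoP/(_ e e0) H := diff_locally df.
  have fg0 : \forall h \near (0 : V), f (h + x) = g (h + x).
    by move: fg; rewrite (near_shift 0) subr0.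
  near=> h; have <- : (f \o shift x - (cst (f x) + 'd f x)) h
      = (g \o shift x - (cst (g x) + 'd f x)) h.
    by rewrite /GRing.add /GRing.opp /= /shift /= fgx; congr (_ - _); near: h.
  by near: h.
have dE : 'd g x = 'd f x :> (V -> W).
  by apply: diff_unique => //; exact: diff_continuous.
split=> //; apply/diff_locallyP; split; last by rewrite dE.
by rewrite dE; exact: diff_continuous.
Unshelve. all: by end_near. Qed.

Lemma Ck_ext k V W (D : set V) (f g : V -> W) :
  open D -> (forall z, D z -> f z = g z) -> Ck k D f -> Ck k D g.
Proof.
move=> oD; elim: k f g => [|k IH] f g fg /=.
  move=> cf z Dz; rewrite /prop_for /continuous_at -(fg z Dz).
  apply: cvg_trans (cf z Dz); apply: near_eq_cvg.
  by near=> t; rewrite -?fg//; near: t; exact: open_nbhs_nbhs.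
have nfg z : D z -> \forall t \near z, f t = g t.
  by move=> Dz; near=> t; apply: fg; near: t; exact: open_nbhs_nbhs.
move=> [df Cf]; split=> [z Dz|v].
  by have [] := near_eq_is_diff (nfg z Dz) (df z Dz).
apply: IH (Cf v) => z Dz.
by have [_ ->] := near_eq_is_diff (nfg z Dz) (df z Dz).
Unshelve. all: by end_near. Qed.

Lemma Ck_le k V W (D : set V) (f : V -> W) : Ck k.+1 D f -> Ck k D f.
Proof.
elim: k f => [|k IH] f [df Cf]; first by move=> z /df /differentiable_continuous.
by split=> // v; apply: IH.
Qed.

Lemma CkD k V W (D : set V) (f g : V -> W) : open D ->
  Ck k D f -> Ck k D g -> Ck k D (f + g).
Proof.
move=> oD; elim: k f g => [|k IH] f g /=.
  by move=> cf cg z Dz; apply: continuousD; [exact: cf|exact: cg].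
move=> [df Cf] [dg Cg]; split=> [z Dz|v].
  by apply: differentiableD; [exact: df|exact: dg].
apply: Ck_ext (IH _ _ (Cf v) (Cg v)) => // z Dz.
by rewrite diffD//; [exact: df|exact: dg].
Qed.

Lemma scale_bilinear_for W :
  bilinear_for (GRing.Scale.Law.clone _ _ *:%R _)
    (GRing.Scale.Law.clone _ _ *:%R _) (fun (a : R) (w : W) => a *: w).
Proof.
split=> [u'|u] a x y /=; first by rewrite scalerDl scalerA.
by rewrite scalerDr !scalerA mulrC.
Qed.

Lemma is_diff_scale V W (f : V -> R) (g : V -> W) z :
  differentiable f z -> differentiable g z ->
  is_diff z (fun t => f t *: g t)
    (fun v => f z *: 'd g z v + 'd f z v *: g z).
Proof.
move=> df dg.
pose B : {bilinear R -> W -> W} :=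
  HB.pack (fun (a : R) (w : W) => a *: w)
    (bilinear_isBilinear.Build R R W W _ _ _ (scale_bilinear_for W)).
have Bc : continuous (fun p : R * W => B p.1 p.2).
  by move=> p; apply: scale_continuous.
have dB p := differentiable_bilin p Bc.
have dfg := differentiable_pair df dg.
split; first exact: (differentiable_comp dfg (dB _)).
rewrite (diff_comp dfg (dB _)) (diff_bilin _ Bc) (diff_pair df dg).
by [].
Qed.

Lemma CkZ k V W (D : set V) (f : V -> R) (g : V -> W) : open D ->
  Ck k D f -> Ck k D g -> Ck k D (fun z => f z *: g z).
Proof.
move=> oD; elim: k f g => [|k IH] f g Cf Cg /=.
  by move=> z Dz; apply: continuousZ; [exact: Cf|exact: Cg].
have [df Cf'] := Cf; have [dg Cg'] := Cg; split=> [z Dz|v].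
  by have [] := is_diff_scale (df z Dz) (dg z Dz).
apply: (Ck_ext oD _ (CkD oD (IH _ _ (Ck_le Cf) (Cg' v))
  (IH _ _ (Cf' v) (Ck_le Cg)))) => z Dz.
by have [_ ->] := is_diff_scale (df z Dz) (dg z Dz).
Qed.

Lemma near_diff_comp (U V W : normedModType R) (f : U -> V) (g : V -> W) (h : U -> W) x y :
  f x = y -> (\forall z \near x, g (f z) = h z) ->
  differentiable f x -> differentiable g y ->
  forall v, 'd g y ('d f x v) = 'd h x v.
Proof.
move=> <- nE df dg v.
have [_ E] := near_eq_is_diff nE (differentiable_comp df dg).
by rewrite E (diff_comp df dg).
Qed.

End Smooth.

(* [psi i] is the inverse of the chart [phi i : dom i -> R^n]; the values of
   [phi i] outside [dom i] and of [psi i] outside the image are irrelevant. *)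
Record smooth_manifold (R : realType) (n : nat) := SmoothManifold {
  space :> topologicalType;
  mfd_hausdorff : hausdorff_space space;
  mfd_countable : @second_countable space;
  chart : Type;
  dom : chart -> set space;
  phi : chart -> space -> 'rV[R]_n;
  psi : chart -> 'rV[R]_n -> space;
  dom_open : forall i, open (dom i);
  dom_cover : forall x, exists i, dom i x;
  img_open : forall i, open (phi i @` dom i);
  phiK : forall i x, dom i x -> psi i (phi i x) = x;
  phi_continuous : forall i x, dom i x -> {for x, continuous (phi i)};
  psi_continuous : forall i z, (phi i @` dom i) z -> {for z, continuous (psi i)};
  transition_smooth : forall i j,
    smooth_on (phi i @` (dom i `&` dom j)) (phi j \o psi i) }.

Arguments dom {R n s}.
Arguments phi {R n s}.
Arguments psi {R n s}.

Section Manifold.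
Context {R : realType} {n : nat} {M : smooth_manifold R n}.
Implicit Types (x y : M) (i j k : chart M).

Definition chart_at x : chart M := projT1 (cid (dom_cover x)).

Lemma chart_atP x : dom (chart_at x) x.
Proof. exact: (projT2 (cid (dom_cover x))). Qed.

Lemma psiK i z : (phi i @` dom i) z -> phi i (psi i z) = z.
Proof. by move=> [x ix <-]; rewrite phiK. Qed.

Lemma nbhs_psi i x (A : set M) : dom i x -> nbhs x A ->
  \forall z \near phi i x, A (psi i z).
Proof.
move=> ix Ax; have ix' : (phi i @` dom i) (phi i x) by exists x.
by apply: (psi_continuous ix'); rewrite /= phiK.
Qed.

Lemma near_psiK i x : dom i x -> \forall z \near phi i x, phi i (psi i z) = z.
Proof.
move=> ix; have : nbhs (phi i x) (phi i @` dom i).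
  by apply: open_nbhs_nbhs; split; [exact: img_open|exists x].
by apply: filterS => z; exact: psiK.
Qed.

Lemma transition_diff i j x : dom i x -> dom j x ->
  differentiable (phi j \o psi i) (phi i x).
Proof. by move=> ix jx; case: (transition_smooth i j 1) => + _; apply; exists x. Qed.

Lemma transition_comp i j k x v : dom i x -> dom j x -> dom k x ->
  'd (phi k \o psi j) (phi j x) ('d (phi j \o psi i) (phi i x) v) =
  'd (phi k \o psi i) (phi i x) v.
Proof.
move=> ix jx kx.
apply: near_diff_comp; last 2 first.
- exact: transition_diff.
- exact: transition_diff.
- by rewrite /= phiK.
- have : nbhs x (dom j) by apply: open_nbhs_nbhs; split => //; exact: dom_open.
  by move=> /(nbhs_psi ix); apply: filterS => z jz /=; rewrite phiK.
Qed.

Lemma transition_id i x v : dom i x -> 'd (phi i \o psi i) (phi i x) v = v.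
Proof.
move=> ix; have nE : \forall z \near phi i x, id z = (phi i \o psi i) z.
  by apply: filterS (near_psiK ix) => z /= ->.
have [di E] := is_diff_id (phi i x).
have [_ ->] := near_eq_is_diff nE di.
by rewrite E.
Qed.

(* A tangent vector at [x] is a family of vectors of R^n, one for each chart
   around [x], which transform by the differentials of the transition maps;
   the components in the charts that do not contain [x] are set to 0. *)
Definition tangent_pred x : {pred chart M -> 'rV[R]_n} := fun u =>
  `[< (forall i, ~ dom i x -> u i = 0) /\
      (forall i j, dom i x -> dom j x ->
         u j = 'd (phi j \o psi i) (phi i x) (u i)) >].

Lemma tangent_submod x : submod_closed (tangent_pred x).
Proof.
split=> [|a u v /asboolP[u0 uc] /asboolP[v0 vc]]; apply/asboolP; split=> //.
- by move=> i j _ _; rewrite linear0.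
- by move=> i ix; rewrite !fctE /= u0// v0// scaler0 addr0.
- by move=> i j ix jx; rewrite linearP -uc// -vc.
Qed.
HB.instance Definition _ x :=
  GRing.isSubmodClosed.Build R (chart M -> 'rV[R]_n) (tangent_pred x)
    (tangent_submod x).

Record tangent x := Tangent {
  tcoord : chart M -> 'rV[R]_n;
  tcoordP : tcoord \in tangent_pred x }.

HB.instance Definition _ x := [isSub for @tcoord x].
HB.instance Definition _ x := [Choice of tangent x by <:].
HB.instance Definition _ x := [SubChoice_isSubLmodule of tangent x by <:].

Lemma tcoord_out x (u : tangent x) i : ~ dom i x -> tcoord u i = 0.
Proof. by have /asboolP[+ _] := tcoordP u; exact. Qed.

Lemma tcoord_compat x (u : tangent x) i j : dom i x -> dom j x ->
  tcoord u j = 'd (phi j \o psi i) (phi i x) (tcoord u i).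
Proof. by have /asboolP[_ +] := tcoordP u; exact. Qed.

Lemma tcoordDZ x (a : R) (u v : tangent x) i :
  tcoord (a *: u + v) i = a *: tcoord u i + tcoord v i.
Proof. by []. Qed.

Lemma tangent_ext x (u v : tangent x) i : dom i x ->
  tcoord u i = tcoord v i -> u = v.
Proof.
move=> ix uv; apply: val_inj; apply/funext => k /=.
have [kx|kx] := pselect (dom k x); last by rewrite !tcoord_out.
by rewrite (tcoord_compat u ix kx) (tcoord_compat v ix kx) uv.
Qed.

Definition tvec_coord x i (v : 'rV[R]_n) : chart M -> 'rV[R]_n := fun k =>
  if `[< dom i x /\ dom k x >] then 'd (phi k \o psi i) (phi i x) v else 0.

Lemma tvec_coordP x i v : tvec_coord x i v \in tangent_pred x.
Proof.
apply/asboolP; rewrite /tvec_coord; split=> [k kx|k l kx lx].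
  by case: asboolP => // -[_ /kx].
have [ix|ix] := pselect (dom i x).
  rewrite (asboolT (conj ix lx)) (asboolT (conj ix kx)); apply/esym.
  exact: transition_comp.
by rewrite !(asboolF (P := dom i x /\ _)) ?linear0// => -[].
Qed.

(* The tangent vector at [x] with component [v] in the chart [i] around [x]. *)
Definition tvec x i (v : 'rV[R]_n) : tangent x := Tangent (tvec_coordP x i v).

Lemma tvecK x i (v : 'rV[R]_n) : dom i x -> tcoord (tvec x i v) i = v.
Proof.
by move=> ix; rewrite /= /tvec_coord (asboolT (conj ix ix)); exact: transition_id.
Qed.

Lemma tcoordK x i (u : tangent x) : dom i x -> tvec x i (tcoord u i) = u.
Proof. by move=> ix; apply: (@tangent_ext _ _ _ i) => //; rewrite tvecK. Qed.

Lemma tvec_linear x i : linear (tvec x i).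
Proof.
move=> a u v; apply: val_inj; apply/funext => k.
rewrite [RHS](_ : _ = a *: tvec_coord x i u k + tvec_coord x i v k)//=.
by rewrite /tvec_coord; case: ifP => _; rewrite ?linearP// scaler0 addr0.
Qed.
HB.instance Definition _ x i :=
  GRing.isLinear.Build R 'rV[R]_n (tangent x) *:%R (tvec x i) (@tvec_linear x i).

Definition smooth_map_on (U : set M) (f : M -> M) : Prop :=
  (forall x, U x -> {for x, continuous f}) /\
  (forall i j, smooth_on (phi i @` (U `&` dom i `&` f @^-1` dom j))
     (phi j \o f \o psi i)).

Definition diffeo_on (U : set M) (f : M -> M) : Prop :=
  [/\ open (f @` U), smooth_map_on U f &
      exists2 g, smooth_map_on (f @` U) g & forall x, U x -> g (f x) = x].

Definition tangent_map (f : M -> M) x (u : tangent x) : tangent (f x) :=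
  let i := chart_at x in let j := chart_at (f x) in
  tvec (f x) j ('d (phi j \o f \o psi i) (phi i x) (tcoord u i)).

Lemma tangent_map_linear f x : linear (@tangent_map f x).
Proof. by move=> a u v; rewrite /tangent_map !linearP. Qed.

Lemma smooth_map_diff U f x i j : smooth_map_on U f -> U x -> dom i x ->
  dom j (f x) -> differentiable (phi j \o f \o psi i) (phi i x).
Proof. by move=> [_ /(_ i j 1%N)[+ _]] Ux ix jfx; apply; exists x. Qed.

Lemma tangent_map_bij U f x : open U -> diffeo_on U f -> U x -> bijective (@tangent_map f x).
Proof.
move=> oU [oV sf [g sg gf]] Ux; set i := chart_at x; set j := chart_at (f x).
have ix : dom i x by exact: chart_atP.
have jfx : dom j (f x) by exact: chart_atP.
have Vfx : (f @` U) (f x) by exists x.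
have igfx : dom i (g (f x)) by rewrite gf.
pose F := phi j \o f \o psi i; pose G := phi i \o g \o psi j.
have dF : differentiable F (phi i x) by exact: smooth_map_diff sf _ _ _.
have dG : differentiable G (phi j (f x)) by exact: smooth_map_diff sg _ _ _.
have Fx : F (phi i x) = phi j (f x) by rewrite /F /= phiK.
have Gfx : G (phi j (f x)) = phi i x by rewrite /G /= phiK// gf.
have nd k y : dom k y -> nbhs y (dom k).
  by move=> ky; apply: open_nbhs_nbhs; split; [exact: dom_open|].
have GF : \forall z \near phi i x, G (F z) = id z.
  have UjN : nbhs x (U `&` f @^-1` dom j).
    apply: filterI; first exact: open_nbhs_nbhs.
    exact: (sf.1 x Ux) (nd _ _ jfx).
  have := nbhs_psi ix UjN; have := near_psiK ix; apply: filterS2 => z iz [Uz jz].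
  by rewrite /G /F /= phiK// gf.
have FG : \forall z \near phi j (f x), F (G z) = id z.
  have VN : nbhs (f x) ((f @` U) `&` g @^-1` dom i).
    apply: filterI; first exact: open_nbhs_nbhs.
    exact: (sg.1 _ Vfx) (nd _ _ igfx).
  have := nbhs_psi jfx VN; have := near_psiK jfx.
  apply: filterS2 => z jz [[t Ut tz] iz].
  by rewrite /G /F /= phiK// -tz gf// tz.
have dI (y v : 'rV[R]_n) : 'd id y v = v.
  by have [_ ->] := is_diff_id y.
exists (fun w : tangent (f x) =>
  tvec x i ('d G (phi j (f x)) (tcoord w j))) => u.
  rewrite /tangent_map -/i -/j tvecK// (near_diff_comp Fx GF)// dI.
  exact: tcoordK.
rewrite /tangent_map -/i -/j tvecK// (near_diff_comp Gfx FG)// dI.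
exact: tcoordK.
Qed.

(* The elements of the groupoid of linear isomorphisms between tangent spaces
   whose source is [x]. *)
Record arrow x := Arrow {
  target : M;
  arrow_fun :> tangent x -> tangent target;
  arrow_linear : linear arrow_fun;
  arrow_bij : bijective arrow_fun }.

Lemma arrow_ext x (a b : arrow x) : target a = target b ->
  (forall u k, tcoord (a u) k = tcoord (b u) k) -> a = b.
Proof.
case: a b => [y f lf bf] [y' g lg bg] /= yy'; subst y' => fg.
have fgE : f = g by apply/funext => u; apply: val_inj; apply/funext => k; exact: fg.
by subst g; congr Arrow; exact: Prop_irrelevance.
Qed.

Lemma opp_linear x : linear (fun u : tangent x => - u).
Proof. by move=> a u v; rewrite opprD scalerN. Qed.

Definition neg_arrow x : arrow x :=
  Arrow (@opp_linear x) (Bijective (@opprK (tangent x)) (@opprK (tangent x))).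

(* The expression of a map of the form [x |-> b x] in the chart of the groupoid
   determined by the chart [i] at the source and the chart [j] at the target:
   the point [target (b x)] and the matrix (acting on row vectors) of [b x]. *)
Definition arrow_coord i j x (a : arrow x) : 'rV[R]_n * 'M[R]_n :=
  (phi j (target a), lin1_mx (fun v => tcoord (a (tvec x i v)) j)).

Definition sec_coord i j (b : forall x, arrow x) (z : 'rV[R]_n) :
  'rV[R]_n * 'M[R]_n := arrow_coord i j (b (psi i z)).

Definition smooth_section_on (U : set M) (b : forall x, arrow x) : Prop :=
  let b0 x := target (b x) in
  (forall x, U x -> {for x, continuous b0}) /\
  (forall i j, smooth_on (phi i @` (U `&` dom i `&` b0 @^-1` dom j))
     (sec_coord i j b)).

(* The values of [bsec] outside the domain [bdom] are irrelevant. *)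
Record bisection := Bisection {
  bdom : set M;
  bsec :> forall x, arrow x;
  bdom_open : open bdom;
  bsec_smooth : smooth_section_on bdom bsec;
  bsec_diffeo : diffeo_on bdom (fun x => target (bsec x)) }.

Definition base (b : bisection) : M -> M := fun x => target (b x).

Definition bisection_at x := {b : bisection | bdom b x}.
HB.instance Definition _ x := gen_eqMixin (bisection_at x).
HB.instance Definition _ x := gen_choiceMixin (bisection_at x).

(* Two bisections have the same 1-jet at [x] when they have the same value at
   [x] and the same differential at [x], the latter being compared in charts. *)
Definition same_jet x (b b' : bisection_at x) : Prop :=
  sval b x = sval b' x /\
  forall i j, dom i x -> dom j (base (sval b) x) ->
    'd (sec_coord i j (sval b)) (phi i x) =
    'd (sec_coord i j (sval b')) (phi i x) :> ('rV[R]_n -> _).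

Lemma same_jet_refl x (b : bisection_at x) : same_jet b b.
Proof. by split; [exact: erefl|move=> i j _ _; exact: erefl]. Qed.

Lemma same_jet_sym x (b b' : bisection_at x) : same_jet b b' -> same_jet b' b.
Proof.
move=> [e d]; split; first exact: esym.
by move=> i j ix jx; apply/esym; apply: d => //; rewrite /base e.
Qed.

Lemma same_jet_trans x (b1 b2 b3 : bisection_at x) :
  same_jet b1 b2 -> same_jet b2 b3 -> same_jet b1 b3.
Proof.
move=> [e d] [e' d']; split; first exact: etrans e'.
move=> i j ix jx; apply: (etrans (d i j ix jx)); apply: d' => //.
by rewrite /base -e.
Qed.

Definition jet_rel x : rel (bisection_at x) := fun b b' => `[< same_jet b b' >].

Lemma jet_rel_refl x : reflexive (@jet_rel x).
Proof. by move=> b; apply: asboolT; exact: same_jet_refl. Qed.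

Lemma jet_rel_sym x : symmetric (@jet_rel x).
Proof. by move=> b b'; apply: asbool_equiv_eq; split; exact: same_jet_sym. Qed.

Lemma jet_rel_trans x : transitive (@jet_rel x).
Proof.
move=> b b1 b2 /asboolW e /asboolW e'; apply: asboolT.
exact: same_jet_trans e e'.
Qed.

Canonical jet_equiv x :=
  EquivRel (@jet_rel x) (@jet_rel_refl x) (@jet_rel_sym x) (@jet_rel_trans x).

Definition jet x := {eq_quot (@jet_rel x)}%qT.

Definition jet1 x (b : bisection_at x) : jet x := (\pi_(jet x) b)%qT.

Definition jet_repr x (eta : jet x) : bisection := sval (repr eta).

Definition jet_p x (eta : jet x) : arrow x := jet_repr eta x.

Definition base_diff (b : bisection) x (bx : bdom b x) : arrow x :=
  Arrow (@tangent_map_linear (base b) x) (tangent_map_bij (bdom_open b) (bsec_diffeo b) bx).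

Definition jet_pstar x (eta : jet x) : arrow x :=
  base_diff (svalP (repr eta)).

Lemma jet1P x (b b' : bisection_at x) : jet1 b = jet1 b' <-> same_jet b b'.
Proof.
split=> e; first by move/eqmodP: e => e; exact: asboolW e.
by apply/eqmodP; exact: asboolT.
Qed.

Lemma same_jet_repr x (b : bisection_at x) : same_jet (repr (jet1 b)) b.
Proof. by apply/jet1P; exact: reprK. Qed.

Lemma jet_p1 x (b : bisection_at x) : jet_p (jet1 b) = sval b x.
Proof. by have [] := same_jet_repr b. Qed.

Lemma diff_base (b : bisection) x i j : bdom b x -> dom i x ->
  dom j (base b x) -> forall v,
  'd (phi j \o base b \o psi i) (phi i x) v =
  ('d (sec_coord i j b) (phi i x) v).1.
Proof.
move=> bx ix jx v.
have db : differentiable (sec_coord i j b) (phi i x).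
  by case: (bsec_smooth b) => _ /(_ i j 1%N)[+ _]; apply; exists x.
pose B : 'rV[R]_n -> 'rV[R]_n * 'M[R]_n := sec_coord i j b.
have fc : continuous (fst : 'rV[R]_n * 'M[R]_n -> 'rV[R]_n).
  by move=> p; exact: cvg_fst.
pose fl : {linear ('rV[R]_n * 'M[R]_n)%type -> 'rV[R]_n} := fst.
have df (p : 'rV[R]_n * 'M[R]_n) : differentiable fl p.
  exact: linear_differentiable.
have nE : \forall z \near phi i x, fl (B z) = (phi j \o base b \o psi i) z.
  by near=> z.
rewrite -(near_diff_comp (erefl (B (phi i x))) nE db (df _)).
by rewrite (@diff_lin _ _ _ fl _ fc).
Unshelve. all: by end_near. Qed.

Lemma base_diff_eq (b b' : bisection) x (bx : bdom b x) (bx' : bdom b' x) :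
  b x = b' x ->
  (forall i j, dom i x -> dom j (base b x) ->
    'd (sec_coord i j b) (phi i x) =
    'd (sec_coord i j b') (phi i x) :> ('rV[R]_n -> _)) ->
  base_diff bx = base_diff bx'.
Proof.
move=> e d.
have eb : base b x = base b' x := congr1 (@target x) e.
apply: (@arrow_ext x (base_diff bx) (base_diff bx')); first exact: eb.
move=> u k; set i := chart_at x; set j := chart_at (base b x).
have ix : dom i x by exact: chart_atP.
have jx : dom j (base b x) by exact: chart_atP.
have jx' : dom j (base b' x) by rewrite -eb.
have dE v : 'd (phi j \o base b \o psi i) (phi i x) v =
            'd (phi j \o base b' \o psi i) (phi i x) v.
  apply: (etrans (diff_base bx ix jx v)); apply/esym.
  apply: (etrans (diff_base bx' ix jx' v)).
  exact: (congr1 (fun h => (h v).1) (esym (d i j ix jx))).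
change (tvec_coord (base b x) j
    ('d (phi j \o base b \o psi i) (phi i x) (tcoord u i)) k =
  tvec_coord (base b' x) (chart_at (base b' x))
    ('d (phi (chart_at (base b' x)) \o base b' \o psi i) (phi i x)
       (tcoord u i)) k).
apply: (etrans (congr1 (fun w => tvec_coord (base b x) j w k) (dE _))).
exact: (congr1 (fun y => tvec_coord y (chart_at y)
  ('d (phi (chart_at y) \o base b' \o psi i) (phi i x) (tcoord u i)) k) eb).
Qed.

Lemma jet_pstar1 x (b : bisection_at x) :
  jet_pstar (jet1 b) = base_diff (svalP b).
Proof. by have [e d] := same_jet_repr b; exact: base_diff_eq. Qed.

Definition semi_holonomic x (eta : jet x) : Prop := jet_p eta = jet_pstar eta.

(* Smoothness is tested on the coordinates of the jets: the point and the matrix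
   given by [sec_coord] and their differentials. *)
Definition smooth_jets (s : forall x, jet x) : Prop :=
  let y x := target (jet_p (s x)) in
  let c i j z := sec_coord i j (jet_repr (s (psi i z))) in
  continuous y /\
  (forall i j, let D := phi i @` (dom i `&` y @^-1` dom j) in
     smooth_on D (fun z => c i j z z) /\
     (forall v, smooth_on D (fun z => 'd (c i j z) z v))).

Record symmetry_jet := SymmetryJet {
  sj :> forall x, jet x;
  sj_semi_holonomic : forall x, semi_holonomic (sj x);
  sj_smooth : smooth_jets sj;
  sj_p : forall x, jet_p (sj x) = neg_arrow x;
  sj_pstar : forall x, jet_pstar (sj x) = neg_arrow x }.

Record smooth_function := SmoothFunction {
  sfun :> M -> R;
  sfunP : forall i, smooth_on (phi i @` dom i) (sfun \o psi i) }.

Record vfield := VField {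
  vf :> forall x, tangent x;
  vfP : forall i, smooth_on (phi i @` dom i) (fun z => tcoord (vf (psi i z)) i) }.

Lemma vadd_smooth (X Y : vfield) i : smooth_on (phi i @` dom i)
  (fun z => tcoord (X (psi i z) + Y (psi i z)) i).
Proof. by move=> k; apply: CkD; [exact: img_open|exact: vfP|exact: vfP]. Qed.

Definition vadd (X Y : vfield) : vfield :=
  @VField (fun x => X x + Y x) (vadd_smooth X Y).

Lemma vscale_smooth (f : smooth_function) (X : vfield) i :
  smooth_on (phi i @` dom i) (fun z => tcoord (f (psi i z) *: X (psi i z)) i).
Proof.
move=> k; apply: (CkZ (f := f \o psi i) (g := fun z => tcoord (X (psi i z)) i)).
- exact: img_open.
- exact: sfunP.
- exact: vfP.
Qed.

Definition vscale (f : smooth_function) (X : vfield) : vfield :=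
  @VField (fun x => f x *: X x) (vscale_smooth f X).

Definition dir_deriv (f : M -> R) x (u : tangent x) : R :=
  let i := chart_at x in 'd (f \o psi i) (phi i x) (tcoord u i).

Record affine_connection := AffineConnection {
  cov :> vfield -> vfield -> vfield;
  covDl : forall X X' Y, cov (vadd X X') Y = vadd (cov X Y) (cov X' Y);
  covZl : forall f X Y, cov (vscale f X) Y = vscale f (cov X Y);
  covDr : forall X Y Y', cov X (vadd Y Y') = vadd (cov X Y) (cov X Y');
  covZr : forall f X Y x,
    cov X (vscale f Y) x = f x *: cov X Y x + dir_deriv f (X x) *: Y x }.

(* [X, Z]_x, computed in a chart around [x] by the formula DZ(X) - DX(Z), which
   does not depend on the chart. It depends only on the germs of [X] and [Z] at
   [x], so that it makes sense for vector fields that are smooth near [x]. *)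
Definition bracket (X Z : forall x, tangent x) x : tangent x :=
  let i := chart_at x in
  let X' z := tcoord (X (psi i z)) i in
  let Z' z := tcoord (Z (psi i z)) i in
  tvec x i ('d Z' (phi i x) (X' (phi i x)) - 'd X' (phi i x) (Z' (phi i x))).

(* The local vector field b(Y), extended by 0 outside its domain. *)
Definition push (b : bisection) (Y : forall x, tangent x) y : tangent y :=
  match pselect ((base b @` bdom b) y) with
  | left h => let: exist2 x _ e := cid2 h in
              eq_rect (base b x) tangent (b x (Y x)) y e
  | right _ => 0
  end.

Lemma pushE (b : bisection) Y x : bdom b x -> push b Y (base b x) = b x (Y x).
Proof.
move=> bx; rewrite /push; case: pselect => [h|[]]; last by exists x.
case: (cid2 h) => x' bx' e /=.
have [_ _ [g _ gK]] := bsec_diffeo b.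
have xx' : x' = x.
  by rewrite -(gK _ bx') -(gK _ bx); congr g; exact: e.
by subst x'; rewrite (Prop_irrelevance e (erefl (base b x))).
Qed.

End Manifold.

Arguments tangent {R n} M x.
Arguments vfield {R n} M.
Arguments symmetry_jet {R n} M.
Arguments affine_connection {R n} M.

(* Main.v *)
From HB Require Import structures.
Require Import Defs.
From mathcomp Require Import all_boot all_order all_algebra.
From mathcomp Require Import all_classical all_reals all_analysis.
From mathcomp Require Import ring lra.

(* In a chart at x, let (beta, A) be the local expression of a bisection b with
   b(x) = -I and tangent map -I, and let Z = Y + b(Y). Then Z(x) = 0 and
   dZ v = 2 dY v - (dA v) Y, so that the half bracket at x is
   dY X - (dA X) Y / 2: the Christoffel symbol of the connection is -dA / 2.
   Since Z(x) = 0, this expression holds in every chart around x without any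
   symmetry of second derivatives.

   A jet with p = p_* = -I is determined by dA, and vector fields with
   prescribed values extend to M by bump functions, hence injectivity.
   Conversely, a connection is local (bump functions again) and thus has
   Christoffel symbols; for any linear L, the jet at x with dA = L is realised
   by the reflection z |-> 2 phi(x) - z together with the matrices
   -1 + L (z - phi(x)), in a ball where they are invertible. *)

Set Implicit Arguments.
Unset Strict Implicit.
Unset Printing Implicit Defensive.

Import Order.TTheory GRing.Theory Num.Theory.
Import numFieldNormedType.Exports.

Local Open Scope classical_set_scope.
Local Open Scope ring_scope.

(** * Smooth maps between normed spaces *)

Section Calculus.
Context {R : realType}.
Implicit Types (U V W : normedModType R) (k : nat).

(** The obstacle is uniformity in x: [bracket], [tangent_map] and the bisection attached to a
    connection all use the chart [chart_at x], which is chosen without any continuity in x. Every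
    formula at x is therefore transferred to an arbitrary chart around x, so that one fixed chart
    serves a whole neighbourhood. For the jets of a connection the transfer goes through the
    connection itself: they are built point by point, but in each chart around x their half bracket
    has to give back the connection, which forces dA = -2 G with G the Christoffel symbols of that
    chart, and these depend smoothly on the point. The reason why dA determines the jet: since p_* =
    -I, the base map has differential -1 in every chart around x, and a new chart at the target
    multiplies A by a Jacobian matrix, so that the product rule yields the differential in every
    pair of charts. *)

Lemma sum_continuous (T : topologicalType) W (I : Type) (r : seq I)
    (F : I -> T -> W) x :
  (forall a, {for x, continuous (F a)}) ->
  {for x, continuous (fun z => \sum_(a <- r) F a z)}.
Proof.
move=> cF; elim: r => [|a r IH].
  rewrite (_ : (fun z => _) = cst 0); first exact: cst_continuous.
  by apply/funext => z; rewrite big_nil.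
rewrite (_ : (fun z => _) = F a + fun z => \sum_(b <- r) F b z).
  by apply: continuousD; [exact: cF|exact: IH].
by apply/funext => z; rewrite big_cons.
Qed.

Lemma mx_linear_continuous m n W (l : {linear 'M[R]_(m, n) -> W}) :
  continuous l.
Proof.
have -> : (l : _ -> _) = fun A => \sum_i \sum_j A i j *: l (delta_mx i j).
  apply/funext => A; rewrite [in LHS](matrix_sum_delta A) linear_sum.
  apply: eq_bigr => i _; rewrite linear_sum; apply: eq_bigr => j _.
  by rewrite linearZ.
move=> A; apply: sum_continuous => i; apply: sum_continuous => j.
by apply: continuousZr_tmp; exact: coord_continuous.
Qed.

Lemma Ck_sub k V W (D E : set V) (f : V -> W) :
  D `<=` E -> Ck k E f -> Ck k D f.
Proof.
move=> DE; elim: k f => [|k IH] f /=; first by move=> cf z /DE; exact: cf.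
by move=> [df Cf]; split=> [z /DE|v]; [exact: df|exact: IH].
Qed.

(** Each clause of [Ck] is a condition at a point, involving a full neighbourhood of it in the whole
    space; the sets [E] can therefore be arbitrary and vary with the point. *)
Lemma Ck_local k V W (D : set V) (f : V -> W) :
  (forall z, D z -> exists2 E, E z & Ck k E f) -> Ck k D f.
Proof.
elim: k f => [|k IH] f /= H; first by move=> z Dz; have [E Ez] := H z Dz; exact.
split=> [z Dz|v]; first by have [E Ez [+ _]] := H z Dz; exact.
by apply: IH => z Dz; have [E Ez [_ Cf]] := H z Dz; exists E.
Qed.

Lemma Ck_cst k V W (D : set V) (a : W) : Ck k D (cst a).
Proof.
elim: k a => [|k IH] a /=; first by move=> z _; exact: cst_continuous.
split=> [z _|v]; first exact: differentiable_cst.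
by rewrite (_ : (fun z => _) = cst 0)//; apply/funext => z; rewrite diff_cst.
Qed.

Lemma Ck_lin k V V' W (D : set V) (l : {linear V' -> W}) (f : V -> V') :
  open D -> continuous l -> Ck k D f -> Ck k D (fun z => l (f z)).
Proof.
move=> oD cl; elim: k f => [|k IH] f /=.
  by move=> cf z Dz; apply: continuous_comp; [exact: cf|exact: cl].
move=> [df Cf]; split=> [z Dz|v].
  by apply: differentiable_comp; [exact: df|exact: linear_differentiable].
apply: Ck_ext (IH _ (Cf v)) => // z Dz.
rewrite (@diff_comp _ _ _ _ f l)/=; [|exact: df|exact: linear_differentiable].
by rewrite diff_lin.
Qed.

Lemma Ck_id k V (D : set V) : Ck k D id.
Proof.
case: k => [|k] /=; first by move=> z _; exact: cvg_id.
split=> [z _|v]; first by have [] := is_diff_id z.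
rewrite (_ : (fun z => _) = cst v); first exact: Ck_cst.
by apply/funext => z; have [_ ->] := is_diff_id z.
Qed.

Lemma Ck_sum k V W (I : Type) (r : seq I) (D : set V) (F : I -> V -> W) :
  open D -> (forall a, Ck k D (F a)) ->
  Ck k D (fun z => \sum_(a <- r) F a z).
Proof.
move=> oD CF; elim: r => [|a r IH].
  by under eq_fun do rewrite big_nil; exact: Ck_cst.
under eq_fun do rewrite big_cons.
by apply: CkD.
Qed.

Lemma CkN k V W (D : set V) (f : V -> W) : open D ->
  Ck k D f -> Ck k D (fun z => - f z).
Proof.
move=> oD Cf; have H := CkZ oD (@Ck_cst k V R D (-1)) Cf.
by apply: Ck_ext H => // z _; rewrite /= scaleN1r.
Qed.

Section Bilinear.
Context {U V W : normedModType R} (B : {bilinear U -> V -> W}).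
Hypothesis Bc : continuous (fun p : U * V => B p.1 p.2).

Lemma is_diff_bilin (T : normedModType R) (f : T -> U) (g : T -> V) z :
  differentiable f z -> differentiable g z ->
  is_diff z (fun t => B (f t) (g t))
    (fun v => B (f z) ('d g z v) + B ('d f z v) (g z)).
Proof.
move=> df dg; have dB p := differentiable_bilin p Bc.
have dfg := differentiable_pair df dg.
split; first exact: (differentiable_comp dfg (dB _)).
by rewrite (diff_comp dfg (dB _)) (diff_bilin _ Bc) (diff_pair df dg).
Qed.

Lemma Ck_bilin k (T : normedModType R) (D : set T) (f : T -> U) (g : T -> V) :
  open D -> Ck k D f -> Ck k D g -> Ck k D (fun z => B (f z) (g z)).
Proof.
move=> oD; elim: k f g => [|k IH] f g Cf Cg.
  move=> z Dz /=.
  have fgc : {for z, continuous (fun t => (f t, g t))}.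
    by apply: cvg_pair; [exact: Cf|exact: Cg].
  exact: (continuous_comp fgc (@Bc (f z, g z))).
have [df Cf'] := Cf; have [dg Cg'] := Cg; split=> [z Dz|v].
  by have [] := is_diff_bilin (df z Dz) (dg z Dz).
apply: (Ck_ext oD _ (CkD oD (IH _ _ (Ck_le Cf) (Cg' v))
  (IH _ _ (Cf' v) (Ck_le Cg)))) => z Dz.
by have [_ ->] := is_diff_bilin (df z Dz) (dg z Dz).
Qed.

End Bilinear.

Section MatrixProduct.
Context {m n p : nat}.

Lemma mulmx_bilinear_for :
  bilinear_for (GRing.Scale.Law.clone _ _ *:%R _)
    (GRing.Scale.Law.clone _ _ *:%R _) (@mulmx R m n p).
Proof.
split=> [A|A] a B C /=; first by rewrite mulmxDl scalemxAl.
by rewrite mulmxDr scalemxAr.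
Qed.

Definition mulmx_bilin : {bilinear 'M[R]_(m, n) -> 'M[R]_(n, p) -> 'M[R]_(m, p)} :=
  HB.pack (@mulmx R m n p)
    (bilinear_isBilinear.Build R _ _ _ _ _ _ mulmx_bilinear_for).

Lemma continuous_mulmx (T : topologicalType) (F : T -> 'M[R]_(m, n))
    (G : T -> 'M[R]_(n, p)) x :
  {for x, continuous F} -> {for x, continuous G} ->
  {for x, continuous (fun z => F z *m G z)}.
Proof.
move=> cF cG; rewrite (_ : (fun z => _) =
    fun z => \sum_i \sum_j (\sum_a F z i a * G z a j) *: delta_mx i j).
  apply: sum_continuous => i; apply: sum_continuous => j.
  apply: continuousZr_tmp; apply: sum_continuous => a.
  apply: (@continuousM _ _ (fun z => F z i a) (fun z => G z a j)).
    exact: (continuous_comp cF (@coord_continuous _ _ _ _ _ _)).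
  exact: (continuous_comp cG (@coord_continuous _ _ _ _ _ _)).
apply/funext => q; rewrite [LHS]matrix_sum_delta.
by apply: eq_bigr => i _; apply: eq_bigr => j _; rewrite /= mxE.
Qed.

Lemma mulmx_bilin_continuous :
  continuous (fun q : 'M[R]_(m, n) * 'M[R]_(n, p) => mulmx_bilin q.1 q.2).
Proof.
by move=> q; apply: continuous_mulmx; [exact: cvg_fst|exact: cvg_snd].
Qed.

Lemma is_diff_mulmx V (F : V -> 'M[R]_(m, n)) (G : V -> 'M[R]_(n, p)) z :
  differentiable F z -> differentiable G z ->
  is_diff z (fun t => F t *m G t) (fun v => F z *m 'd G z v + 'd F z v *m G z).
Proof. exact: (is_diff_bilin mulmx_bilin_continuous). Qed.

Lemma Ck_mulmx k V (D : set V) (F : V -> 'M[R]_(m, n)) (G : V -> 'M[R]_(n, p)) :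
  open D -> Ck k D F -> Ck k D G -> Ck k D (fun z => F z *m G z).
Proof. exact: (Ck_bilin mulmx_bilin_continuous). Qed.

End MatrixProduct.

(** The chain rule differentiates [g] in the direction ['d f z v], which moves with [z], whereas
    [Ck] controls fixed directions only. Expanding that direction in a finite basis [e] with
    coordinates [p] reduces to fixed ones. The abstract basis covers both row vectors and [R]
    itself. *)
Lemma Ck_comp_basis V (I : finType) (e : I -> V) (p : I -> {linear V -> R}) :
  (forall u, u = \sum_a p a u *: e a) -> (forall a, continuous (p a)) ->
  forall k U W (D : set U) (E : set V) (f : U -> V) (g : V -> W), open D ->
  (forall z, D z -> E (f z)) -> Ck k D f -> Ck k E g -> Ck k D (g \o f).
Proof.
move=> pE pc; elim=> [|k IH] U W D E f g oD DE Cf Cg.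
  move=> z Dz; apply: continuous_comp; first exact: Cf.
  by move: (DE z Dz) => /Cg.
have [df Cf'] := Cf; have [dg Cg'] := Cg; split=> [z Dz|v].
  by apply: differentiable_comp; [exact: df|apply: dg; exact: DE].
apply: (@Ck_ext _ _ _ _ _
    (fun z => \sum_a p a ('d f z v) *: ('d g (f z) (e a)))) => // [z Dz|].
  rewrite (@diff_comp _ _ _ _ f g)/=; [|exact: df|by apply: dg; exact: DE].
  rewrite [in RHS](pE ('d f z v)) linear_sum.
  by apply: eq_bigr => a _; rewrite linearZ.
apply: Ck_sum => // a; apply: CkZ => //.
  exact: (Ck_lin oD (pc a) (Cf' v)).
exact: (IH _ _ _ _ f (fun y => 'd g y (e a)) oD DE (Ck_le Cf) (Cg' _)).
Qed.

Lemma coord_linear m n (i : 'I_m) (j : 'I_n) :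
  linear (fun A : 'M[R]_(m, n) => A i j : R).
Proof. by move=> a A B; rewrite !mxE. Qed.

Definition coord_lin m n (i : 'I_m) (j : 'I_n) : {linear 'M[R]_(m, n) -> R} :=
  HB.pack (fun A : 'M[R]_(m, n) => A i j : R)
    (GRing.isLinear.Build R _ _ _ _ (@coord_linear m n i j)).

Lemma Ck_comp n k U W (D : set U) (E : set 'rV[R]_n) (f : U -> 'rV[R]_n)
    (g : 'rV[R]_n -> W) : open D ->
  (forall z, D z -> E (f z)) -> Ck k D f -> Ck k E g -> Ck k D (g \o f).
Proof.
apply: (@Ck_comp_basis _ _ (delta_mx 0) (coord_lin 0)); last first.
  by move=> a; exact: mx_linear_continuous.
by move=> u; exact: row_sum_delta.
Qed.

Lemma Ck_compR k U W (D : set U) (E : set R) (f : U -> R)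
    (g : R -> W) : open D ->
  (forall z, D z -> E (f z)) -> Ck k D f -> Ck k E g -> Ck k D (g \o f).
Proof.
have pE (u : R) : u = \sum_(a : unit) idfun u *: (1 : R).
  by rewrite big_const card_unit /= addr0; apply/esym/mulr1.
have pc (a : unit) : continuous (idfun : {linear R -> R}).
  by move=> x; exact: cvg_id.
exact: (Ck_comp_basis (p := fun=> idfun) pE pc).
Qed.

Lemma Ck_coord k V m n (D : set V) (F : V -> 'M[R]_(m, n)) i j : open D ->
  Ck k D F -> Ck k D (fun z => F z i j : R).
Proof.
by move=> oD; apply: (Ck_lin (l := coord_lin i j)); last exact: mx_linear_continuous.
Qed.

Lemma Ck_mx k V m n (D : set V) (F : V -> 'M[R]_(m, n)) : open D ->
  (forall i j, Ck k D (fun z => F z i j : R)) -> Ck k D F.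
Proof.
move=> oD CF; apply: (@Ck_ext _ _ _ _ _
    (fun z => \sum_i \sum_j F z i j *: delta_mx i j)) => // [z _|].
  by rewrite -matrix_sum_delta.
apply: Ck_sum => // i; apply: Ck_sum => // j; apply: CkZ => //; exact: Ck_cst.
Qed.

Lemma Ck_lin1_mx k V m n (D : set V) (F : V -> {linear 'rV[R]_m -> 'rV[R]_n}) :
  open D -> (forall v, Ck k D (fun z => F z v)) ->
  Ck k D (fun z => lin1_mx (F z)).
Proof.
move=> oD CF; apply: Ck_mx => // i j.
have := Ck_coord 0 j oD (CF (delta_mx 0 i)).
by apply: Ck_ext => // z _; rewrite mxE.
Qed.

Lemma Ck_pair k U V W (D : set U) (f : U -> V) (g : U -> W) : open D ->
  Ck k D f -> Ck k D g -> Ck k D (fun z => (f z, g z)).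
Proof.
move=> oD; elim: k f g => [|k IH] f g /=.
  by move=> cf cg z Dz; apply: cvg_pair; [exact: cf|exact: cg].
move=> [df Cf] [dg Cg]; split=> [z Dz|v].
  by apply: differentiable_pair; [exact: df|exact: dg].
apply: Ck_ext (IH _ _ (Cf v) (Cg v)) => // z Dz.
by rewrite diff_pair; [|exact: df|exact: dg].
Qed.

Lemma Ck_fst k U V W (D : set U) (f : U -> V * W) : open D ->
  Ck k D f -> Ck k D (fun z => (f z).1).
Proof.
by move=> oD; apply: (Ck_lin (l := fst)) => // p; exact: cvg_fst.
Qed.

Lemma Ck_snd k U V W (D : set U) (f : U -> V * W) : open D ->
  Ck k D f -> Ck k D (fun z => (f z).2).
Proof.
by move=> oD; apply: (Ck_lin (l := snd)) => // p; exact: cvg_snd.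
Qed.

(** The derivative of 1/f is -(1/f)(1/f) df, in which 1/f is already of class C^k by induction. *)
Lemma CkV k V (D : set V) (f : V -> R) : open D ->
  (forall z, D z -> f z != 0) -> Ck k D f -> Ck k D (fun z => (f z)^-1).
Proof.
move=> oD f0; elim: k => [|k IH] Cf.
  by move=> z Dz; apply: cvgV; [exact: f0|exact: Cf].
have [df Cf'] := Cf; split=> [z Dz|v].
  by apply: differentiableV; [exact: df|exact: f0].
apply: (Ck_ext oD _ (CkZ oD (CkN oD (CkZ oD (IH (Ck_le Cf)) (IH (Ck_le Cf))))
  (Cf' v))) => z Dz.
rewrite diffV ?f0//; last exact: df.
by rewrite /= expr2 invfM.
Qed.

End Calculus.

(** * A smooth plateau function *)

Section Bump.
Context {R : realType}.
Implicit Types (p : {poly R}) (t : R).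

(** The polynomial factor makes the family closed under differentiation, so that one induction gives
    smoothness; p = 1 is the classical flat function. *)
Definition flat p t : R := if 0 < t then p.[t^-1] * expR (- t^-1) else 0.

(** Trading a factor X for a factor t turns a bound on [flat ('X * p)] into decay of [flat p] at 0,
    and exhibits the difference quotient of [flat p] at 0. *)
Lemma flatXM p t : flat ('X * p) t * t = flat p t.
Proof.
rewrite /flat; case: ifPn => [t0|_]; last by rewrite mul0r.
by rewrite hornerM hornerX mulrAC -mulrA mulrACA mulVf ?gt_eqF// mul1r mulrC.
Qed.


Lemma horner_expRN_bounded p : exists2 C, 0 <= C &
  forall s, 0 < s -> `|p.[s] * expR (- s)| <= C.
Proof.
(* Each monomial satisfies s^i <= i! e^s for s > 0, by the exponential series. *)
exists (\sum_(i < size p) `|p`_i| * (i`!)%:R).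
  by apply: sumr_ge0 => i _; rewrite mulr_ge0.
move=> s s0; rewrite horner_coef mulr_suml.
apply: le_trans (ler_norm_sum _ _ _) _; apply: ler_sum => i _.
rewrite -mulrA normrM ler_wpM2l// ger0_norm; last first.
  by rewrite mulr_ge0 ?exprn_ge0 ?expR_ge0// ltW.
rewrite expRN ler_pdivrMr ?expR_gt0// -ler_pdivrMl ?ltr0n ?fact_gt0//.
case: (nat_of_ord i) => [|k].
  by rewrite fact0 invr1 mul1r expr0 -expR0 ler_expR ltW.
rewrite mulrC; apply: le_trans (expR_ge1Dxn k (ltW s0)).
by rewrite lerDr.
Qed.

Lemma flat_le p : exists C, forall t, `|flat p t| <= C * `|t|.
Proof.
have [C C0 HC] := horner_expRN_bounded ('X * p); exists C => t.
rewrite -flatXM normrM ler_wpM2r// /flat; case: ifPn => [t0|_].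
  by apply: HC; rewrite invr_gt0.
by rewrite normr0.
Qed.

Lemma flat_continuous0 p : {for 0, continuous (flat p)}.
Proof.
have [C HC] := flat_le p.
have f0 : flat p 0 = 0 by rewrite /flat ltxx.
rewrite /prop_for /continuous_at f0.
apply/norm_cvg0P; apply: (@squeeze_cvgr _ _ _ _ (cst 0) (fun t => C * `|t|)).
- by near=> t; rewrite /= normr_ge0 HC.
- exact: cvg_cst.
- rewrite -[X in _ --> X](mulr0 C); apply: cvgM; first exact: cvg_cst.
  by rewrite -[X in _ --> X](@normr0 _ R); apply: cvg_norm; exact: cvg_id.
Unshelve. all: by end_near. Qed.

(** For t > 0, both p(1/t) and exp(-1/t) contribute a factor t^-2, that is X^2 evaluated at 1/t,
    with opposite signs: hence p - p'. *)
Lemma is_derive_flat p t :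
  is_derive t 1 (flat p) (flat ('X * 'X * (p - p^`())) t).
Proof.
case: (ltgtP t 0) => [t0|t0|->].
- rewrite {2}/flat ltNge ltW//=; apply: (@near_eq_is_derive _ _ _ (cst 0)).
  near=> s; rewrite /flat ltNge ltW//=; near: s.
  exact: lt_nbhsl.
- have tn0 : t != 0 by rewrite gt_eqF.
  have D1 : is_derive t 1 (fun s : R => s^-1) (- t ^- 2 *: 1).
    by apply: (@is_deriveV _ id) => //; exact: is_derive_id.
  have D2 := is_derive1_comp (is_derive_poly p t^-1) D1.
  have DN := is_deriveN D1.
  have D3 := @is_derive1_comp _ _ (- (fun s : R => s^-1)) t _ _
    (is_derive_expR (- t^-1)) DN.
  have D4 := is_deriveM D2 D3.
  apply: (@near_eq_is_derive _ _ _
    (fun s => (horner p \o (fun s => s^-1)) s * (expR \o (fun s : R => - s^-1)) s)).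
    near=> s; rewrite /flat ifT//; near: s; exact: lt_nbhsr.
  apply: is_derive_eq.
  rewrite /flat t0 !hornerE /= !scaler1 /GRing.scale /=.
  rewrite -[(- _) t]/(- t^-1).
  by field.
(* By [flatXM], [flat ('X * p)] is the slope function at 0; it is continuous there with value 0. *)
- apply/is_derive1_caratheodory; exists (flat ('X * p)); split.
  + by move=> z; rewrite subr0 flatXM {2}/flat ltxx subr0.
  + exact: flat_continuous0.
  + by rewrite /flat ltxx.
Unshelve. all: by end_near. Qed.

Lemma Ck_flat k p : Ck k setT (flat p).
Proof.
have df q t : differentiable (flat q) t.
  by apply/derivable1_diffP; apply: ex_derive; exact: is_derive_flat.
elim: k p => [|k IH] p; first by move=> t _; exact: differentiable_continuous.
split=> [t _|v]; first exact: df.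
apply: (Ck_ext openT _ (CkZ openT (@Ck_cst _ k _ _ _ v)
  (IH ('X * 'X * (p - p^`()))))) => t _.
rewrite diff1E//= derive1E; congr (_ *: _).
by have [_ ->] := is_derive_flat p t.
Qed.

Definition plateau t : R := flat 1 t / (flat 1 t + flat 1 (1 - t)).

Lemma flat1_ge0 t : 0 <= flat 1 t.
Proof. by rewrite /flat; case: ifP => // _; rewrite hornerC mul1r expR_ge0. Qed.

Lemma flat1_gt0 t : 0 < t -> 0 < flat 1 t.
Proof. by move=> t0; rewrite /flat t0 hornerC mul1r expR_gt0. Qed.

(** The numbers t and 1 - t are never both nonpositive, so one of the two nonnegative summands is
    positive. *)
Lemma plateau_den t : flat 1 t + flat 1 (1 - t) != 0.
Proof.
rewrite gt_eqF//; have [t0|t0] := ltP 0 t.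
  by rewrite ltr_pwDl ?flat1_gt0 ?flat1_ge0.
rewrite ltr_wpDl ?flat1_ge0// flat1_gt0// subr_gt0.
exact: le_lt_trans t0 ltr01.
Qed.

Lemma plateau0 t : t <= 0 -> plateau t = 0.
Proof. by move=> t0; rewrite /plateau {1}/flat ltNge t0 mul0r. Qed.

Lemma plateau1 t : 1 <= t -> plateau t = 1.
Proof.
move=> t1; have E : flat 1 (1 - t) = 0 by rewrite /flat subr_gt0 ltNge t1.
by rewrite /plateau; have := plateau_den t; rewrite E addr0 => /divff.
Qed.

Lemma Ck_plateau k : Ck k setT plateau.
Proof.
apply: (CkZ openT (Ck_flat k 1)
  (@CkV _ _ _ _ (fun t => flat 1 t + flat 1 (1 - t)) openT _ _)).
  by move=> t _; exact: plateau_den.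
apply: (CkD openT (Ck_flat k 1)).
apply: (@Ck_compR _ _ _ _ _ setT (fun t => 1 - t) (flat 1) openT) => //.
  exact: (Ck_ext openT _ (CkD openT (@Ck_cst _ k R R _ 1)
    (CkN openT (@Ck_id _ k R _)))).
exact: Ck_flat.
Qed.

End Bump.

(** * Charts and extension of local data *)

Lemma mul_rV_lin1_of_linear (R : comNzRingType) m n (f : 'rV[R]_m -> 'rV[R]_n) u :
  linear f -> u *m lin1_mx f = f u.
Proof.
move=> lf; pose fl : {linear 'rV[R]_m -> 'rV[R]_n} :=
  HB.pack f (GRing.isLinear.Build R _ _ _ f lf).
exact: (mul_rV_lin1 fl).
Qed.

Section Charts.
Context {R : realType} {n : nat} {M : smooth_manifold R n}.
Implicit Types (x y : M) (i j k : chart M).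

Lemma nbhs_dom i x : dom i x -> nbhs x (dom i).
Proof. by move=> ix; apply: open_nbhs_nbhs; split => //; exact: dom_open. Qed.

Lemma open_chart_image i (A : set M) : open A -> open (phi i @` (A `&` dom i)).
Proof.
move=> oA; rewrite openE => _ [x [Ax ix] <-].
have Ai : nbhs x (A `&` dom i).
  by apply: filterI; [exact: open_nbhs_nbhs|exact: nbhs_dom].
have := nbhs_psi ix Ai; have := near_psiK ix; apply: filterS2 => z zE Az.
by exists (psi i z).
Qed.

(** The Jacobian of a change of chart, acting on row vectors from the right. As a matrix it can be
    differentiated in [z] and multiplied with the matrices of [sec_coord]. *)
Definition transition_mx i j (z : 'rV[R]_n) : 'M[R]_n :=
  lin1_mx ('d (phi j \o psi i) z).

Lemma mul_transition_mx i j z v :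
  v *m transition_mx i j z = 'd (phi j \o psi i) z v.
Proof. exact: mul_rV_lin1. Qed.

Lemma tcoord_change x (u : tangent M x) i j : dom i x -> dom j x ->
  tcoord u j = tcoord u i *m transition_mx i j (phi i x).
Proof. by move=> ix jx; rewrite mul_transition_mx; exact: tcoord_compat. Qed.

Lemma open_overlap i j : open (phi i @` (dom i `&` dom j)).
Proof. by rewrite setIC; apply: open_chart_image; exact: dom_open. Qed.

Lemma smooth_transition_mx i j :
  smooth_on (phi i @` (dom i `&` dom j)) (transition_mx i j).
Proof.
move=> k; apply: Ck_lin1_mx => [|v]; first exact: open_overlap.
by have [_ +] := transition_smooth i j k.+1; exact.
Qed.

(** Near a point of [dom i], compose with the transition map; any other point lies in the complement
    of [K], which is open because [K] is closed, and there [f] vanishes. *)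
Lemma smooth_function_glue i (K : set M) (f : M -> R) :
  closed K -> K `<=` dom i -> (forall y, ~ K y -> f y = 0) ->
  smooth_on (phi i @` dom i) (f \o psi i) ->
  forall j, smooth_on (phi j @` dom j) (f \o psi j).
Proof.
move=> cK Ki f0 sf j k; apply: Ck_local => _ [y jy <-].
have [iy|niy] := pselect (dom i y).
  exists (phi j @` (dom j `&` dom i)); first by exists y.
  have oD := @open_overlap j i.
  apply: (@Ck_ext _ _ _ _ _ ((f \o psi i) \o (phi i \o psi j))) => //.
    by move=> _ [t [jt it] <-] /=; rewrite !phiK.
  apply: (Ck_comp oD _ (transition_smooth j i k) (sf k)).
  by move=> _ [t [jt it] <-] /=; exists t => //; rewrite phiK.
exists (phi j @` (~` K `&` dom j)).
  by exists y => //; split=> // /Ki.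
apply: (@Ck_ext _ _ _ _ _ (cst 0)).
- by apply: open_chart_image; exact: closed_openC.
- by move=> _ [t [Kt jt] <-] /=; rewrite phiK// f0.
- exact: Ck_cst.
Qed.

(** The two cases are those of [smooth_function_glue]; in the first one the coordinates are moreover
    multiplied by the Jacobian of the transition. *)
Lemma smooth_vfield_glue i (K : set M) (V : forall y, tangent M y) :
  closed K -> K `<=` dom i -> (forall y, ~ K y -> V y = 0) ->
  smooth_on (phi i @` dom i) (fun z => tcoord (V (psi i z)) i) ->
  forall j, smooth_on (phi j @` dom j) (fun z => tcoord (V (psi j z)) j).
Proof.
move=> cK Ki V0 sV j k; apply: Ck_local => _ [y jy <-].
have [iy|niy] := pselect (dom i y).
  exists (phi j @` (dom j `&` dom i)); first by exists y.
  have oD := @open_overlap j i.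
  pose T := phi i \o psi j.
  apply: (@Ck_ext _ _ _ _ _ (fun z =>
      ((fun w => tcoord (V (psi i w)) i) \o T) z *m (transition_mx i j \o T) z)) => //.
    move=> _ [t [jt it] <-]; rewrite /T/= (phiK jt) (phiK it).
    by rewrite -tcoord_change.
  have TD : forall z, (phi j @` (dom j `&` dom i)) z ->
      (phi i @` (dom i `&` dom j)) (T z).
    by move=> _ [t [jt it] <-]; rewrite /T /=; exists t => //; rewrite phiK.
  apply: Ck_mulmx => //.
    apply: (Ck_comp oD _ (transition_smooth j i k) (sV k)).
    by move=> z /TD[t [it _] tz]; exists t.
  exact: (Ck_comp oD TD (transition_smooth j i k) (@smooth_transition_mx i j k)).
exists (phi j @` (~` K `&` dom j)).
  by exists y => //; split=> // /Ki.
apply: (@Ck_ext _ _ _ _ _ (cst 0)).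
- by apply: open_chart_image; exact: closed_openC.
- by move=> _ [t [Kt jt] <-] /=; rewrite phiK// V0.
- exact: Ck_cst.
Qed.

(** The norm on rows is the maximum norm, which is not smooth; bump functions are built from the
    squared Euclidean distance instead. *)
Definition sqdist (c z : 'rV[R]_n) : R := \sum_a (z 0 a - c 0 a) ^+ 2.

Lemma Ck_sqdist (k : nat) c (D : set 'rV[R]_n) : open D -> Ck k D (sqdist c).
Proof.
move=> oD; apply: Ck_sum => // a.
have C : Ck k D (fun z : 'rV[R]_n => z 0 a - c 0 a).
  exact: (Ck_ext oD _ (CkD oD (Ck_coord 0 a oD (@Ck_id _ k _ D))
    (@Ck_cst _ k _ _ D (- c 0 a)))).
exact: (CkZ oD C C).
Qed.

Lemma sqdist_coord (c z : 'rV[R]_n) a : (z 0 a - c 0 a) ^+ 2 <= sqdist c z.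
Proof.
rewrite /sqdist (bigD1 a)//= lerDl; apply: sumr_ge0 => b _; exact: sqr_ge0.
Qed.

Lemma sqdist_le_norm (c z : 'rV[R]_n) d : 0 < d -> sqdist c z <= d ^+ 2 -> `|c - z| <= d.
Proof.
move=> d0 H; rewrite /Num.Def.normr/= mx_normrE.
apply: bigmax_le => [|[b a] _] /=; first exact: ltW.
rewrite !mxE ord1 distrC -ler_sqr ?nnegrE ?(ltW d0)// real_normK ?num_real//.
exact: le_trans (sqdist_coord c z a) H.
Qed.

Lemma exists_bump i x (A : set M) : dom i x -> nbhs x A ->
  exists (f : @smooth_function R n M) (K : set M),
  [/\ closed K, K `<=` A `&` dom i, forall y, ~ K y -> f y = 0 &
      \forall y \near x, f y = 1].
Proof.
move=> ix Ax; pose c := phi i x.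
have : nbhs c (phi i @` (A `&` dom i)).
  have Ai : nbhs x (A `&` dom i) by apply: filterI; [|exact: nbhs_dom].
  have := nbhs_psi ix Ai; have := near_psiK ix; apply: filterS2 => z zE Az.
  by exists (psi i z).
move=> /nbhs_ballP[r /= r0 rW].
(* The closed Euclidean ball of radius r/2 lies in the open ball of radius r for the maximum norm,
   since that norm is at most the Euclidean one. *)
pose d := r / 2; have d0 : 0 < d by rewrite divr_gt0.
pose K0 := [set z | sqdist c z <= d ^+ 2].
have K0W : K0 `<=` phi i @` (A `&` dom i).
  move=> z /(sqdist_le_norm d0) zd; apply: rW; rewrite -ball_normE /=.
  by apply: le_lt_trans zd _; rewrite /d; lra.
have sqc : continuous (sqdist c).
  by move=> z; exact: (@Ck_sqdist 0 c setT openT z I).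
have cK0 : compact K0.
  apply: bounded_closed_compact.
    exists (`|c| + d); split; first exact: num_real.
    move=> m cdm z /(sqdist_le_norm d0) zd; apply: le_trans (ltW cdm).
    rewrite -[z](subKr c); apply: le_trans (ler_normB _ _) _.
    by rewrite lerD2l.
  exact: (closed_comp (fun z _ => @sqc z) (@closed_le _ (d ^+ 2))).
pose K := psi i @` K0.
(* [K] is compact as the continuous image of a closed bounded set; it is closed because [M] is
   Hausdorff. *)
have cK : closed K.
  apply: compact_closed; first exact: mfd_hausdorff.
  apply: continuous_compact cK0; apply: continuous_in_subspaceT => z.
  by rewrite inE => /K0W[y [_ iy] yz]; apply: psi_continuous; exists y.
have KAi : K `<=` A `&` dom i.
  by move=> _ [z /K0W[y Aiy <-] <-]; rewrite phiK//; case: Aiy.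
have Ki : K `<=` dom i by move=> y /KAi[].
(* The argument of [plateau] is at most 0 once the squared distance reaches d^2, and at least 1
   while it stays below d^2 / 2. *)
pose h z := plateau (2 - 2 / d ^+ 2 * sqdist c z).
pose f y := if `[< dom i y >] then h (phi i y) else 0.
have f0 y : ~ K y -> f y = 0.
  move=> nK; rewrite /f; case: asboolP => // iy.
  apply: plateau0; rewrite subr_le0 mulrAC ler_pdivlMr ?exprn_gt0// ler_pM2l//.
  rewrite leNgt; apply/negP => lt; apply: nK; exists (phi i y); last exact: phiK.
  exact: ltW.
have sf : smooth_on (phi i @` dom i) (f \o psi i).
  move=> k; have oD := @img_open _ _ M i.
  apply: (@Ck_ext _ _ _ _ _ h) => //.
    by move=> _ [y iy <-]; rewrite /f /= phiK// asboolT.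
  apply: (@Ck_compR _ k _ _ _ setT (fun z => 2 - 2 / d ^+ 2 * sqdist c z)
    plateau oD) => //; last exact: Ck_plateau.
  apply: (@Ck_ext _ k _ R _
    (cst 2 + fun z => - (2 / d ^+ 2) *: sqdist c z)) => // [z _|].
    by rewrite -[LHS]/(2 + - (2 / d ^+ 2) * sqdist c z) mulNr.
  apply: CkD => //; first exact: Ck_cst.
  apply: (CkZ oD (@Ck_cst _ k _ R _ (- (2 / d ^+ 2)))).
  exact: Ck_sqdist.
exists (SmoothFunction (smooth_function_glue cK Ki f0 sf)), K; split=> //=.
have nc : \forall z \near c, sqdist c z < d ^+ 2 / 2.
  have sqcc : sqdist c c < d ^+ 2 / 2.
    rewrite /sqdist big1 ?divr_gt0 ?exprn_gt0// => a _.
    by rewrite subrr expr0n.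
  exact: (@sqc c _ (lt_nbhsl sqcc)).
have nx : \forall y \near x, sqdist c (phi i y) < d ^+ 2 / 2 := phi_continuous ix nc.
have := nbhs_dom ix; apply: filterS2 nx => y yc iy.
rewrite /f asboolT//; apply: plateau1.
rewrite lerBrDr -lerBrDl; apply: le_trans (_ : 2 / d ^+ 2 * (d ^+ 2 / 2) <= _).
  by rewrite ler_pM2l ?divr_gt0 ?exprn_gt0// ltW.
by rewrite mulrA divfK ?gt_eqF ?exprn_gt0// divff//; lra.
Qed.

(** The field with constant coordinate [v], cut off by a bump function. The equality holds near [x]
    and not only at [x], so these fields also serve as local frames with constant coordinates. *)
Lemma exists_vfield i x v : dom i x ->
  exists X : vfield M, \forall y \near x, tcoord (X y) i = v.
Proof.
move=> ix; have [f [K [cK KAi f0 f1]]] := exists_bump ix filterT.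
have Ki : K `<=` dom i by move=> y /KAi[].
pose V y := f y *: tvec y i v.
have sV : smooth_on (phi i @` dom i) (fun z => tcoord (V (psi i z)) i).
  move=> k; have oD := @img_open _ _ M i.
  apply: (Ck_ext oD _ (CkZ oD (@sfunP _ _ _ f i k) (@Ck_cst _ k _ _ _ v))).
  by move=> _ [y iy <-]; rewrite /= phiK// -[RHS]/(f y *: tcoord (tvec y i v) i) tvecK.
have V0 y : ~ K y -> V y = 0 by move=> /f0 fy; rewrite /V fy scale0r.
exists (VField (smooth_vfield_glue cK Ki V0 sV)) => /=.
have := nbhs_dom ix; apply: filterS2 f1 => y fy iy.
by rewrite -[LHS]/(f y *: tcoord (tvec y i v) i) tvecK// fy scale1r.
Qed.

Lemma exists_smooth_function i x (g : 'rV[R]_n -> R) : dom i x ->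
  smooth_on (phi i @` dom i) g ->
  exists f : @smooth_function R n M, \forall y \near x, f y = g (phi i y).
Proof.
move=> ix sg; have [f [K [cK KAi f0 f1]]] := exists_bump ix filterT.
have Ki : K `<=` dom i by move=> y /KAi[].
pose h y := f y * g (phi i y).
have sh : smooth_on (phi i @` dom i) (h \o psi i).
  move=> k; have oD := @img_open _ _ M i.
  apply: (Ck_ext oD _ (CkZ oD (@sfunP _ _ _ f i k) (sg k))).
  by move=> _ [y iy <-]; rewrite /h /= phiK.
have h0 y : ~ K y -> h y = 0 by move=> /f0 fy; rewrite /h fy mul0r.
exists (SmoothFunction (smooth_function_glue cK Ki h0 sh)) => /=.
by apply: filterS f1 => y fy; rewrite /h fy mul1r.
Qed.

End Charts.

(** * Locality of connections and Christoffel symbols *)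

Section Connections.
Context {R : realType} {n : nat} {M : smooth_manifold R n}.
Implicit Types (x y : M) (i j : chart M) (X Y Z : vfield M).

Lemma vfield_ext X Y : (forall x, X x = Y x) -> X = Y.
Proof.
case: X Y => [X HX] [Y HY] /= XY; have E : X = Y by apply: functional_extensionality_dep.
by subst Y; congr VField; exact: Prop_irrelevance.
Qed.

Lemma affine_connection_ext (N N' : affine_connection M) :
  (forall X Y x, N X Y x = N' X Y x) -> N = N'.
Proof.
case: N N' => [N N1 N2 N3 N4] [N' N1' N2' N3' N4'] /= NN.
have E : N = N'.
  by apply/funext => X; apply/funext => Y; apply: vfield_ext => x; exact: NN.
by subst N'; congr AffineConnection; exact: Prop_irrelevance.
Qed.

Definition vcoord (X : forall x, tangent M x) i (z : 'rV[R]_n) : 'rV[R]_n :=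
  tcoord (X (psi i z)) i.

Lemma vcoordE (X : forall x, tangent M x) i x :
  dom i x -> vcoord X i (phi i x) = tcoord (X x) i.
Proof. by move=> ix; rewrite /vcoord phiK. Qed.

Lemma smooth_vcoord X i : smooth_on (phi i @` dom i) (vcoord X i).
Proof. exact: vfP. Qed.

Lemma vcoord_differentiable X i x :
  dom i x -> differentiable (vcoord X i) (phi i x).
Proof. by move=> ix; have [+ _] := @smooth_vcoord X i 1%N; apply; exists x. Qed.

Lemma smooth_cst (a : R) i : smooth_on (phi i @` dom i) ((fun _ : M => a) \o psi i).
Proof. by move=> k; exact: Ck_cst. Qed.

Definition cst_function (a : R) : @smooth_function R n M :=
  SmoothFunction (smooth_cst a).

Lemma smooth_vzero i :
  smooth_on (phi i @` dom i) (fun z => tcoord (0 : tangent M (psi i z)) i).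
Proof. by move=> k; exact: Ck_cst. Qed.

Definition vzero : vfield M := @VField _ _ _ (fun=> 0) smooth_vzero.

Definition vsum (I : Type) (r : seq I) (E : I -> vfield M) : vfield M :=
  foldr (fun a => vadd (E a)) vzero r.

Lemma vsumE I (r : seq I) E x : vsum r E x = \sum_(a <- r) E a x.
Proof.
elim: r => [|a r IH] /=; first by rewrite big_nil.
by rewrite big_cons -IH.
Qed.

Lemma dir_derivE (f : @smooth_function R n M) i x (u : tangent M x) :
  dom i x -> dir_deriv f u = 'd (f \o psi i) (phi i x) (tcoord u i).
Proof.
move=> ix; have cx := chart_atP x.
rewrite /dir_deriv (tcoord_compat u cx ix); apply/esym.
apply: near_diff_comp.
- by rewrite /= phiK.
- apply: filterS (nbhs_psi cx (nbhs_dom ix)) => z iz /=.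
  by rewrite phiK.
- exact: transition_diff.
- by have [+ _] := sfunP f i 1%N; apply; exists x.
Qed.

(** * Locality of a connection in both arguments *)

Section Locality.
Variable N : affine_connection M.

Lemma cov0l Y x : N vzero Y x = 0.
Proof.
have -> : vzero = vscale (cst_function 0) vzero.
  by apply: vfield_ext => y /=; rewrite scaler0.
by rewrite covZl /= scale0r.
Qed.

Lemma cov0r X x : N X vzero x = 0.
Proof.
have -> : vzero = vscale (cst_function 0) vzero.
  by apply: vfield_ext => y /=; rewrite scaler0.
by rewrite covZr /= scale0r scaler0 addr0.
Qed.

Lemma cov_vsuml I (r : seq I) E Y x : N (vsum r E) Y x = \sum_(a <- r) N (E a) Y x.
Proof.
elim: r => [|a r IH] /=; first by rewrite big_nil cov0l.
by rewrite big_cons covDl /= IH.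
Qed.

Lemma cov_vsumr I (r : seq I) X E x : N X (vsum r E) x = \sum_(a <- r) N X (E a) x.
Proof.
elim: r => [|a r IH] /=; first by rewrite big_nil cov0r.
by rewrite big_cons covDr /= IH.
Qed.

(** A bump function supported where [Z] vanishes kills [Z] globally and has value 1 at [x]; the
    product rules of a connection then yield locality. *)
Lemma near_vzeroP Z x : (\forall y \near x, Z y = 0) ->
  exists f : @smooth_function R n M, f x = 1 /\ vscale f Z = vzero.
Proof.
move=> Z0; have [f [K [_ KA f0 f1]]] := exists_bump (chart_atP x) Z0.
exists f; split; first exact: nbhs_singleton f1.
apply: vfield_ext => y /=; have [/KA[+ _]|/f0 ->] := pselect (K y).
  by move=> /= ->; rewrite scaler0.
by rewrite scale0r.
Qed.

Lemma cov_near0l Z Y x : (\forall y \near x, Z y = 0) -> N Z Y x = 0.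
Proof.
move=> /near_vzeroP[f [fx fZ]]; have := cov0l Y x.
by rewrite -fZ covZl /= fx scale1r.
Qed.

Lemma cov_near0r X Z x : (\forall y \near x, Z y = 0) -> N X Z x = 0.
Proof.
move=> Z0; have [f [fx fZ]] := near_vzeroP Z0; have := cov0r X x.
(* The derivative term of the Leibniz rule is a multiple of [Z x], which is 0. *)
by rewrite -fZ covZr fx scale1r (nbhs_singleton Z0) scaler0 addr0.
Qed.

Let diff X Y : vfield M := vadd X (vscale (cst_function (-1)) Y).

Let diffP X Y : X = vadd (diff X Y) Y.
Proof. by apply: vfield_ext => y /=; rewrite scaleN1r subrK. Qed.

Let diff_near X Y x : (\forall y \near x, X y = Y y) ->
  \forall y \near x, diff X Y y = 0.
Proof. by apply: filterS => y /= ->; rewrite scaleN1r subrr. Qed.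

Lemma cov_nearl X X' Y x : (\forall y \near x, X y = X' y) -> N X Y x = N X' Y x.
Proof.
by move=> /diff_near D; rewrite (diffP X X') covDl /= cov_near0l// add0r.
Qed.

Lemma cov_nearr X Y Y' x : (\forall y \near x, Y y = Y' y) -> N X Y x = N X Y' x.
Proof.
by move=> /diff_near D; rewrite (diffP Y Y') covDr /= cov_near0r// add0r.
Qed.

End Locality.

Lemma exists_frame i x : dom i x -> exists E : 'I_n -> vfield M,
  \forall y \near x, dom i y /\ forall a, tcoord (E a y) i = delta_mx 0 a.
Proof.
move=> ix; have [E HE] := choice (fun a => exists_vfield (delta_mx 0 a) ix).
exists E; apply: filterI; first exact: nbhs_dom.
exact: filter_forall.
Qed.

Lemma vscaleE f X x : vscale f X x = f x *: X x.
Proof. by []. Qed.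

Lemma tcoord_sum x i (I : Type) (r : seq I) (u : I -> tangent M x) :
  tcoord (\sum_(a <- r) u a) i = \sum_(a <- r) tcoord (u a) i.
Proof.
pose t (v : tangent M x) := tcoord v i.
by rewrite -/(t _); elim/big_rec2: _ => [|a v w _ <-].
Qed.

Lemma tcoordZ x i a (u : tangent M x) : tcoord (a *: u) i = a *: tcoord u i.
Proof. by []. Qed.

Lemma tcoordD x i (u v : tangent M x) : tcoord (u + v) i = tcoord u i + tcoord v i.
Proof. by []. Qed.

Lemma exists_frame_decomp i x X (E : 'I_n -> vfield M) : dom i x ->
  (\forall y \near x, dom i y /\ forall a, tcoord (E a y) i = delta_mx 0 a) ->
  exists f : 'I_n -> @smooth_function R n M,
    (\forall y \near x, forall a, f a y = vcoord X i (phi i y) 0 a) /\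
    \forall y \near x,
      X y = vsum (index_enum 'I_n) (fun a => vscale (f a) (E a)) y.
Proof.
move=> ix HE.
have sX a : smooth_on (phi i @` dom i) (fun z => vcoord X i z 0 a : R).
  by move=> k; apply: Ck_coord; [exact: img_open|exact: smooth_vcoord].
have [f Hf] := choice (fun a => exists_smooth_function ix (sX a)).
have {}Hf : \forall y \near x, forall a, f a y = vcoord X i (phi i y) 0 a.
  exact: filter_forall.
exists f; split=> //; apply: filterS2 HE Hf => y [iy Ey] fy.
apply: (tangent_ext iy); rewrite vsumE.
rewrite tcoord_sum [LHS]row_sum_delta; apply: eq_bigr => a _.
by rewrite vscaleE tcoordZ fy Ey vcoordE.
Qed.

(** By locality, [X] and [Y] can be replaced by their expansions in the frame, whose coefficients
    are extended to global functions. The derivatives of the coefficients of [Y] in the Leibniz rule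
    add up to the differential of its coordinates. *)
Lemma cov_frame (N : affine_connection M) X Y i x (E : 'I_n -> vfield M) :
  dom i x ->
  (\forall y \near x, dom i y /\ forall a, tcoord (E a y) i = delta_mx 0 a) ->
  tcoord (N X Y x) i = 'd (vcoord Y i) (phi i x) (tcoord (X x) i) +
    \sum_a \sum_b (tcoord (X x) i 0 a * tcoord (Y x) i 0 b) *:
      tcoord (N (E a) (E b) x) i.
Proof.
move=> ix HE.
have [f [fX XE]] := exists_frame_decomp X ix HE.
have [g [gY YE]] := exists_frame_decomp Y ix HE.
have [_ Ex] := nbhs_singleton HE.
rewrite (cov_nearl N Y XE) cov_vsuml tcoord_sum.
have dY := vcoord_differentiable Y ix.
have dg b v : 'd (g b \o psi i) (phi i x) v = 'd (vcoord Y i) (phi i x) v 0 b.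
  have dc A : differentiable (coord_lin 0 b : 'rV[R]_n -> R) A.
    by apply: linear_differentiable; exact: mx_linear_continuous.
  have nE : \forall z \near phi i x,
      coord_lin 0 b (vcoord Y i z) = (g b \o psi i) z.
    have := nbhs_psi ix gY; have := near_psiK ix; apply: filterS2 => z zE /= ->.
    by rewrite zE.
  rewrite -(near_diff_comp erefl nE dY (dc _)) diff_lin//.
  exact: mx_linear_continuous.
rewrite [X in _ = 'd _ _ X + _]row_sum_delta linear_sum -big_split.
rewrite /=; apply: eq_bigr => a _; rewrite covZl vscaleE tcoordZ.
rewrite (nbhs_singleton fX) vcoordE// linearZ/=.
have -> : \sum_b (tcoord (X x) i 0 a * tcoord (Y x) i 0 b) *:
      tcoord (N (E a) (E b) x) i =
    tcoord (X x) i 0 a *: \sum_b tcoord (Y x) i 0 b *: tcoord (N (E a) (E b) x) i.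
  by rewrite scaler_sumr; apply: eq_bigr => b _; rewrite scalerA.
rewrite -scalerDr; congr (_ *: _).
rewrite (cov_nearr N (E a) YE) cov_vsumr tcoord_sum.
rewrite [X in _ = X + _]row_sum_delta -big_split; apply: eq_bigr => b _.
rewrite covZr tcoordD !tcoordZ (dir_derivE _ _ ix) dg !Ex.
by rewrite (nbhs_singleton gY) vcoordE// addrC.
Qed.

(** Row b of [G a] holds the coordinates of the derivative of [E b] along [E a]. The frame defining
    [G] is chosen anew at each point, so smoothness is not visible in the definition. It follows
    from the formula: applied to one fixed frame near a point, where the coordinates of [E b] are
    constant, it identifies [G] with the smooth coordinates of [N (E a) (E b)]. *)
Lemma exists_christoffel (N : affine_connection M) i :
  exists G : 'I_n -> 'rV[R]_n -> 'M[R]_n,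
    (forall a, smooth_on (phi i @` dom i) (G a)) /\
    forall X Y x, dom i x ->
      tcoord (N X Y x) i = 'd (vcoord Y i) (phi i x) (tcoord (X x) i) +
        tcoord (Y x) i *m \sum_a tcoord (X x) i 0 a *: G a (phi i x).
Proof.
pose fr x (ix : dom i x) := projT1 (cid (exists_frame ix)).
pose G a z : 'M[R]_n := match pselect (dom i (psi i z)) with
  | left iz => \matrix_(b < n) tcoord (N (fr _ iz a) (fr _ iz b) (psi i z)) i
  | right _ => 0 end.
have NE X Y x : dom i x ->
      tcoord (N X Y x) i = 'd (vcoord Y i) (phi i x) (tcoord (X x) i) +
        tcoord (Y x) i *m \sum_a tcoord (X x) i 0 a *: G a (phi i x).
  move=> ix.
  have [E [HE GE]] : exists E : 'I_n -> vfield M,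
      (\forall y \near x, dom i y /\ forall a, tcoord (E a y) i = delta_mx 0 a) /\
      forall a, G a (phi i x) = \matrix_(b < n) tcoord (N (E a) (E b) x) i.
    rewrite /G phiK//; case: pselect => // ix'.
    by exists (fr _ ix'); split=> //; exact: projT2 (cid (exists_frame ix')).
  rewrite (cov_frame N X Y ix HE); congr (_ + _).
  rewrite mulmx_sumr; apply: eq_bigr => a _.
  rewrite -scalemxAr GE mulmx_sum_row scaler_sumr; apply: eq_bigr => b _.
  by rewrite rowK scalerA.
exists G; split=> // a k; apply: Ck_local => _ [x ix <-].
have [E HE] := exists_frame ix.
have := HE; rewrite /prop_near1 nbhsE => -[A [oA Ax] AE].
exists (phi i @` (A `&` dom i)); first by exists x.
have oD := @open_chart_image _ _ _ i _ oA.
pose H := fun z => \matrix_(b < n) vcoord (N (E a) (E b)) i z.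
apply: (@Ck_ext _ _ _ _ _ H) => //.
  move=> _ [y [Ay iy] <-]; apply/row_matrixP => b; rewrite rowK vcoordE//.
  have [_ Ey] := AE _ Ay; rewrite NE// !Ey.
  have -> : 'd (vcoord (E b) i) (phi i y) (delta_mx 0 a) = 0.
    have nE : \forall z \near phi i y, cst (delta_mx 0 b) z = vcoord (E b) i z.
      have nA : nbhs y A by exact: open_nbhs_nbhs.
      apply: filterS (nbhs_psi iy nA) => z /AE[_ Ez].
      by rewrite /vcoord Ez.
    by have [_ ->] := near_eq_is_diff nE (differentiable_cst _ _); rewrite diff_cst.
  rewrite add0r -rowE (bigD1 a)//= big1 => [|c ca].
    by rewrite mxE !eqxx scale1r addr0.
  by rewrite mxE (negbTE ca) andbF scale0r.
apply: Ck_mx => // b c.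
apply: (@Ck_ext _ _ _ _ _ (fun z => vcoord (N (E a) (E b)) i z 0 c)) => //.
  by move=> z _; rewrite /H mxE.
apply: (@Ck_sub _ _ _ _ _ (phi i @` dom i)).
  by move=> _ [y [_ iy] <-]; exists y.
by apply: Ck_coord; [exact: img_open|exact: smooth_vcoord].
Qed.

End Connections.

(** * The half bracket in a chart *)

Section IsDiff.
Context {R : realType}.
Implicit Types U V W : normedModType R.

Lemma near_is_diff V W (f g : V -> W) (df : V -> W) x :
  (\forall z \near x, f z = g z) -> is_diff x f df -> is_diff x g df.
Proof.
move=> fg [df_ dfE]; have [dg dgE] := near_eq_is_diff fg df_.
by split; [exact: dg|exact: etrans dgE dfE].
Qed.

Lemma is_diff_unique V W (f df dg : V -> W) x :
  is_diff x f df -> is_diff x f dg -> df =1 dg.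
Proof. by move=> [_ <-] [_ <-]. Qed.

Lemma is_diff_pt V W (f df : V -> W) x v : is_diff x f df -> 'd f x v = df v.
Proof. by move=> [_ <-]. Qed.

Lemma is_diff_compE U V W (f df : U -> V) (g dg : V -> W) x y :
  f x = y -> is_diff x f df -> is_diff y g dg ->
  is_diff x (fun z => g (f z)) (fun v => dg (df v)).
Proof. by move=> <- Hf Hg; exact: is_diff_comp. Qed.

Lemma is_diff_snd U V W (f df : U -> V * W) x :
  is_diff x f df -> is_diff x (fun z => (f z).2) (fun v => (df v).2).
Proof.
move=> Hf; have sc : continuous (snd : V * W -> W) by move=> p; exact: cvg_snd.
pose s : {linear (V * W)%type -> W} := snd.
have Hs p : is_diff p s s.
  by split; [exact: linear_differentiable|rewrite diff_lin].
exact: (is_diff_comp Hf (Hs _)).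
Qed.

Lemma is_diff_mulmxE V m n p (F dF : V -> 'M[R]_(m, n)) (G dG : V -> 'M[R]_(n, p)) z :
  is_diff z F dF -> is_diff z G dG ->
  is_diff z (fun t => F t *m G t) (fun v => F z *m dG v + dF v *m G z).
Proof. by move=> [HF <-] [HG <-]; exact: is_diff_mulmx. Qed.

End IsDiff.

Lemma subr_linear0 (R : pzRingType) (U V : lmodType R) (f g : {linear U -> V}) u w :
  w = 0 -> f u - g w = f u.
Proof. by move=> ->; rewrite linear0 subr0. Qed.

Lemma nbhsI (T : topologicalType) (x : T) (A B : set T) :
  nbhs x A -> nbhs x B -> nbhs x (A `&` B).
Proof. exact: filterI. Qed.

(** * Arrows, tangent maps and brackets in arbitrary charts *)

Section Arrows.
Context {R : realType} {n : nat} {M : smooth_manifold R n}.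
Implicit Types (x y : M) (i j k : chart M).

Lemma arrow_coordE x (a : arrow x) (u : tangent M x) i j : dom i x ->
  tcoord (a u) j = tcoord u i *m (arrow_coord i j a).2.
Proof.
move=> ix; rewrite /arrow_coord /= mul_rV_lin1_of_linear ?tcoordK//.
by move=> t v w; rewrite linearP arrow_linear.
Qed.

Lemma arrow_coordP x (a : arrow x) i j (B : 'M[R]_n) :
  (forall v, tcoord (a (tvec x i v)) j = v *m B) -> (arrow_coord i j a).2 = B.
Proof.
move=> aB; apply/row_matrixP => k; rewrite !rowE -aB mul_rV_lin1_of_linear//.
by move=> t v w; rewrite linearP arrow_linear.
Qed.

Lemma arrow_coord_change x (a : arrow x) i j k :
  dom j (target a) -> dom k (target a) ->
  (arrow_coord i k a).2 =
  (arrow_coord i j a).2 *m transition_mx j k (phi j (target a)).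
Proof.
move=> ja ka; apply: arrow_coordP => v.
rewrite (tcoord_change _ ja ka) mulmxA; congr (_ *m _).
by rewrite mul_rV_lin1_of_linear// => t u w; rewrite linearP arrow_linear.
Qed.

Lemma arrow_coord_neg x i j : dom i x -> dom j x ->
  (arrow_coord i j (neg_arrow x)).2 = - transition_mx i j (phi i x).
Proof.
move=> ix jx; apply: arrow_coordP => v.
rewrite -[LHS]/(- tcoord (tvec x i v) j) (tcoord_change _ ix jx) tvecK//.
by rewrite mulmxN.
Qed.

Lemma transition_mx_id x i : dom i x -> transition_mx i i (phi i x) = 1%:M.
Proof.
move=> ix; apply/row_matrixP => a; rewrite !rowE mul_transition_mx.
by rewrite transition_id// mulmx1.
Qed.

Lemma sec_coordE (b : forall x, arrow x) x i j : dom i x ->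
  sec_coord i j b (phi i x) = arrow_coord i j (b x).
Proof. by move=> ix; rewrite /sec_coord phiK. Qed.

Lemma transition_mx_differentiable x i j : dom i x -> dom j x ->
  differentiable (transition_mx i j : _ -> 'M[R]_n) (phi i x).
Proof.
by move=> ix jx; have [+ _] := @smooth_transition_mx _ _ M i j 1%N; apply; exists x.
Qed.

(** The chain rule, applied to the transitions at the source and at the target, moves from the
    charts selected in [tangent_map] to [i] and [j]. *)
Lemma tcoord_tangent_map U f x (u : tangent M x) i j : open U -> smooth_map_on U f ->
  U x -> dom i x -> dom j (f x) ->
  tcoord (tangent_map f u) j = 'd (phi j \o f \o psi i) (phi i x) (tcoord u i).
Proof.
move=> oU sf Ux ix jfx; rewrite /tangent_map.
set k := chart_at x; set l := chart_at (f x).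
have kx : dom k x by exact: chart_atP.
have lfx : dom l (f x) by exact: chart_atP.
have d i' j' : dom i' x -> dom j' (f x) ->
  differentiable (phi j' \o f \o psi i') (phi i' x).
  by move=> ix' jx'; exact: smooth_map_diff sf Ux ix' jx'.
rewrite (tcoord_compat _ lfx jfx) tvecK// (tcoord_compat u kx ix).
have E1 v : 'd (phi j \o psi l) (phi l (f x)) ('d (phi l \o f \o psi k) (phi k x) v)
    = 'd (phi j \o f \o psi k) (phi k x) v.
  apply: near_diff_comp; last 2 first.
  - exact: d.
  - exact: transition_diff.
  - by rewrite /= phiK.
  - have := nbhs_psi kx (sf.1 x Ux _ (nbhs_dom lfx)).
    by apply: filterS => z /= lz; rewrite phiK.
have E2 v : 'd (phi j \o f \o psi i) (phi i x) ('d (phi i \o psi k) (phi k x) v)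
    = 'd (phi j \o f \o psi k) (phi k x) v.
  apply: near_diff_comp; last 2 first.
  - exact: transition_diff.
  - exact: d.
  - by rewrite /= phiK.
  - have := nbhs_psi kx (nbhs_dom ix).
    by apply: filterS => z /= iz; rewrite phiK.
exact: (etrans (E1 _) (esym (E2 _))).
Qed.

(** In the chart [k] selected by [bracket], the term DX(Z) vanishes at [x]. To reach the chart [i],
    differentiate the transformation law of the coordinates of [Z]: the derivative of the Jacobian
    comes with the factor Z(x) = 0. *)
Lemma tcoord_bracket (X Z : forall y, tangent M y) x i : dom i x -> Z x = 0 ->
  (forall j, dom j x -> differentiable (vcoord Z j) (phi j x)) ->
  tcoord (bracket X Z x) i = 'd (vcoord Z i) (phi i x) (tcoord (X x) i).
Proof.
move=> ix Zx dZ; set k := chart_at x.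
have kx : dom k x by exact: chart_atP.
rewrite -[bracket X Z x]/(tvec x k ('d (vcoord Z k) (phi k x) (vcoord X k (phi k x)) -
  'd (vcoord X k) (phi k x) (vcoord Z k (phi k x)))).
clearbody k; rewrite (tcoord_compat _ kx ix) tvecK//.
have Zk : tcoord (Z x) k = 0 by rewrite Zx.
have Zk0 : vcoord Z k (phi k x) = 0 by rewrite vcoordE.
rewrite (subr_linear0 _ _ _ Zk0) (vcoordE X kx).
rewrite [in RHS](tcoord_compat (X x) kx ix).
have HW := is_diff_mulmxE (differentiableP (dZ k kx))
  (differentiableP (transition_mx_differentiable kx ix)).
have fx : (phi i \o psi k) (phi k x) = phi i x by rewrite /= phiK.
have nE : \forall z \near phi k x,
    vcoord Z k z *m transition_mx k i z = vcoord Z i ((phi i \o psi k) z).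
  have H := nbhs_psi kx (nbhsI (nbhs_dom ix) (nbhs_dom kx)).
  apply: filterS2 H (near_psiK kx) => z [iz kz] zE /=.
  by rewrite vcoordE// (tcoord_change _ kz iz) zE.
have HC := is_diff_compE fx (differentiableP (transition_diff kx ix))
  (differentiableP (dZ i ix)).
apply: etrans (is_diff_unique (near_is_diff nE HW) HC _).
by rewrite Zk0 mul0mx add0r mul_transition_mx.
Qed.

End Arrows.

(** * First order behaviour of a bisection with value and tangent map -I *)

Section SymmetryBisection.
Context {R : realType} {n : nat} {M : smooth_manifold R n}.
Variables (b : @bisection R n M) (x : M) (bx : bdom b x).
Hypotheses (b_neg : b x = neg_arrow x) (base_diff_neg : base_diff bx = neg_arrow x).
Implicit Types (i j : chart M).

Let base_x : base b x = x.
Proof. by rewrite /base b_neg. Qed.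

Let bdom_near : nbhs x (bdom b).
Proof. by apply: open_nbhs_nbhs; split=> //; exact: bdom_open. Qed.

Let base_near (A : set M) : nbhs x A -> \forall y \near x, A (base b y).
Proof.
move=> Ax; have [_ [+ _] _] := bsec_diffeo b.
by move=> /(_ x bx); apply; rewrite /= -/(base b x) base_x.
Qed.

Let base_loc i : 'rV[R]_n -> 'rV[R]_n := phi i \o base b \o psi i.

Lemma is_diff_base_loc i : dom i x ->
  is_diff (phi i x) (phi i \o base b \o psi i) -%R.
Proof.
move=> ix; have [_ sb _] := bsec_diffeo b.
have ibx : dom i (base b x) by rewrite base_x.
split; first exact: (smooth_map_diff sb).
apply/funext => v.
have := congr1 (fun a : arrow x => tcoord (a (tvec x i v)) i) base_diff_neg.
rewrite -[RHS]/(- tcoord (tvec x i v) i) -[LHS]/(tcoord (tangent_map (base b) _) i).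
by rewrite (tcoord_tangent_map _ (bdom_open b) sb bx ix ibx) tvecK.
Qed.

Lemma sec_coord_differentiable i j : dom i x -> dom j x ->
  differentiable (sec_coord i j b) (phi i x).
Proof.
move=> ix jx; have [_ /(_ i j 1%N)[+ _]] := bsec_smooth b; apply.
by exists x => //; split=> //; rewrite /= -/(base b x) base_x.
Qed.

Lemma sec_coord_neg i j : dom i x -> dom j x ->
  sec_coord i j b (phi i x) = (phi j x, - transition_mx i j (phi i x)).
Proof.
move=> ix jx; rewrite sec_coordE// b_neg -(arrow_coord_neg ix jx).
by rewrite /arrow_coord /=.
Qed.

(** Near [x] the matrix part for the pair (i, j) is that for (i, i) times the Jacobian at the image
    point. In the product rule the value -1 of the first factor cancels the sign from the
    differential -1 of the base map. The right-hand side involves [b] only through the matrix part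
    for (i, i). *)
Lemma diff_sec_coord i j v : dom i x -> dom j x ->
  'd (sec_coord i j b) (phi i x) v =
  (- (v *m transition_mx i j (phi i x)),
   ('d (sec_coord i i b) (phi i x) v).2 *m transition_mx i j (phi i x) +
   'd (transition_mx i j : _ -> 'M[R]_n) (phi i x) v).
Proof.
move=> ix jx; have jbx : dom j (base b x) by rewrite base_x.
have near_i : \forall z \near phi i x, [/\ dom i (psi i z),
    dom i (base b (psi i z)) & dom j (base b (psi i z))].
  have := nbhs_psi ix (nbhsI (nbhs_dom ix)
    (nbhsI (base_near (nbhs_dom ix)) (base_near (nbhs_dom jx)))).
  by apply: filterS => z [? []].
have bc : base_loc i (phi i x) = phi i x by rewrite /base_loc /= phiK// base_x.
have HB := is_diff_base_loc ix.
have HT := differentiableP (transition_mx_differentiable ix jx).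
apply: injective_projections => /=.
  have H1 := is_diff_compE bc HB (differentiableP (transition_diff ix jx)).
  have nE : \forall z \near phi i x,
      (phi j \o psi i) (base_loc i z) = (phi j \o base b \o psi i) z.
    by apply: filterS near_i => z [iz ibz jbz]; rewrite /base_loc /= phiK.
  apply: etrans (esym (diff_base bx ix jbx v)) _.
  apply: etrans (is_diff_pt v (near_is_diff nE H1)) _.
  by rewrite -mulNmx -mul_transition_mx.
have HS := is_diff_snd (differentiableP (sec_coord_differentiable ix ix)).
have HS' := is_diff_snd (differentiableP (sec_coord_differentiable ix jx)).
have HP := is_diff_mulmxE HS (is_diff_compE bc HB HT).
have nE : \forall z \near phi i x, (sec_coord i i b z).2 *m
    transition_mx i j (base_loc i z) = (sec_coord i j b z).2.
  apply: filterS near_i => z [iz ibz jbz].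
  by rewrite /base_loc /= -(@arrow_coord_change _ _ _ _ _ i i j).
apply: etrans (is_diff_unique HS' (near_is_diff nE HP) v) _.
rewrite sec_coord_neg// bc /= transition_mx_id// mulNmx mul1mx addrC.
by congr (_ + _); rewrite -linearN opprK.
Qed.

(** With [g] the inverse of the base map, the coordinates of b(Y) at z are Y(g z) A(g z). Since g
    has differential -1 and A has value -1 at [x], the dY term keeps its sign and the dA term
    changes it. *)
Lemma push_vcoord (Y : vfield M) i : dom i x ->
  is_diff (phi i x) (vcoord (push b Y) i)
    (fun v => 'd (vcoord Y i) (phi i x) v -
       tcoord (Y x) i *m ('d (sec_coord i i b) (phi i x) v).2).
Proof.
move=> ix; have [oV sb [g sg gb]] := bsec_diffeo b.
have Vx : (base b @` bdom b) x by exists x => //; exact: base_x.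
have gx : g x = x by rewrite -{1}base_x; exact: gb.
have Vnear : nbhs x (base b @` bdom b) by apply: open_nbhs_nbhs; split.
pose gl := phi i \o g \o psi i.
have glc : gl (phi i x) = phi i x by rewrite /gl /= phiK// gx.
have dg : differentiable gl (phi i x).
  by apply: (smooth_map_diff sg) => //; rewrite gx.
have bc : base_loc i (phi i x) = phi i x by rewrite /base_loc /= phiK// base_x.
have nK : \forall z \near phi i x, gl (base_loc i z) = id z.
  have H := nbhs_psi ix (nbhsI bdom_near (base_near (nbhs_dom ix))).
  apply: filterS2 H (near_psiK ix) => z [bz ibz] zE; rewrite /gl /base_loc /= phiK//.
  by rewrite -[X in _ = X]zE gb.
(* Differentiate the identity g o base = id, where the base map has differential -1. *)
have Hg : is_diff (phi i x) gl -%R.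
  split=> //; apply/funext => v.
  have H := is_diff_compE bc (is_diff_base_loc ix) (differentiableP dg).
  have := is_diff_unique (near_is_diff nK H) (is_diff_id _) (- v).
  by rewrite opprK.
have HS := is_diff_snd (differentiableP (sec_coord_differentiable ix ix)).
have HY := differentiableP (vcoord_differentiable Y ix).
have HP := is_diff_compE glc Hg (is_diff_mulmxE HY HS).
have gnear : \forall y \near x, dom i (g y).
  have gi : nbhs (g x) (dom i) by rewrite gx; exact: nbhs_dom.
  exact: (sg.1 x Vx _ gi).
have nE : \forall z \near phi i x, vcoord Y i (gl z) *m (sec_coord i i b (gl z)).2 =
    vcoord (push b Y) i z.
  have := nbhs_psi ix (nbhsI (nbhs_dom ix) (nbhsI Vnear gnear)).
  apply: filterS => z [iz [[y yb yz] igz]].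
  have gz : g (psi i z) = y := etrans (congr1 g (esym yz)) (gb _ yb).
  have iy : dom i y by rewrite -gz.
  have -> : gl z = phi i y := congr1 (phi i) gz.
  rewrite vcoordE// sec_coordE// -arrow_coordE// -(pushE Y yb).
  by rewrite /vcoord -yz.
apply: is_diff_eq (near_is_diff nE HP) _; apply/funext => v.
rewrite (vcoordE Y ix) (sec_coord_neg ix ix) transition_mx_id//.
have linN (W : lmodType R) (f : {linear 'rV[R]_n -> W}) : f (- v) = - f v.
  exact: linearN.
rewrite mulmxN mulmx1 addrC; congr (_ + _).
  by apply: etrans (congr1 -%R (linN _ _)) _; rewrite opprK.
by rewrite -mulmxN; congr (_ *m _); exact: (congr1 snd (linN _ _)).
Qed.

Lemma tcoord_half_bracket (X Y : vfield M) i : dom i x ->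
  tcoord (2%:R^-1 *: bracket X (fun y => Y y + push b Y y) x) i =
  'd (vcoord Y i) (phi i x) (tcoord (X x) i) -
  2%:R^-1 *: (tcoord (Y x) i *m
    ('d (sec_coord i i b) (phi i x) (tcoord (X x) i)).2).
Proof.
move=> ix; pose Z y := Y y + push b Y y.
have Zx : Z x = 0.
  have [i0 ix0] := dom_cover x.
  (* The tangent spaces at [base b x] and at [x] are distinct types, equal only through [base_x];
     chart coordinates have a common type in which the vectors can be compared. *)
  have H : tcoord (push b Y (base b x)) i0 = - tcoord (Y x) i0.
    rewrite pushE//.
    exact: (congr1 (fun a : arrow x => tcoord (a (Y x)) i0) b_neg).
  apply: (tangent_ext ix0); rewrite /Z tcoordD.
  have -> : tcoord (push b Y x) i0 = tcoord (push b Y (base b x)) i0 by rewrite base_x.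
  by rewrite H subrr.
have HZ j : dom j x -> is_diff (phi j x) (vcoord Z j)
    (fun v => 2 *: 'd (vcoord Y j) (phi j x) v -
       tcoord (Y x) j *m ('d (sec_coord j j b) (phi j x) v).2).
  move=> jx; have HY := differentiableP (vcoord_differentiable Y jx).
  apply: is_diff_eq (is_diffD HY (push_vcoord Y jx)) _.
  by apply/funext => v /=; rewrite scaler_nat mulr2n -addrA.
have dZ j (jx : dom j x) : differentiable (vcoord Z j) (phi j x).
  by have [] := HZ j jx.
have E := etrans (tcoord_bracket X ix Zx dZ) (is_diff_pt _ (HZ i ix)).
apply: etrans (tcoordZ i _ (bracket X Z x)) _.
apply: etrans (congr1 (fun w => 2%:R^-1 *: w) E) _.
by rewrite scalerBr scalerA mulVf ?scale1r// pnatr_eq0.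
Qed.

End SymmetryBisection.

(** * Symmetry bisections with prescribed derivative *)

Lemma det_continuous (R : realType) (T : topologicalType) n
    (F : T -> 'M[R]_n) x :
  {for x, continuous F} -> {for x, continuous (fun z => \det (F z))}.
Proof.
move=> cF; have cprod (r : seq 'I_n) (s : 'I_n -> 'I_n) :
    {for x, continuous (fun z => \prod_(a <- r) F z a (s a))}.
  elim: r => [|a r IH].
    rewrite (_ : (fun z => _) = cst 1); first exact: cst_continuous.
    by apply/funext => z; rewrite big_nil.
  rewrite (_ : (fun z => _) =
      (fun z => F z a (s a)) \* fun z => \prod_(b <- r) F z b (s b)).
    apply: continuousM; last exact: IH.
    exact: (continuous_comp cF (@coord_continuous _ _ _ _ _ _)).
  by apply/funext => z; rewrite big_cons.
apply: sum_continuous => s.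
by apply: cvgM; [exact: cvg_cst|exact: cprod].
Qed.

(** * The isomorphism of tangent spaces with a given matrix in one chart *)

Section ChartArrow.
Context {R : realType} {n : nat} {M : smooth_manifold R n}.
Variables (i : chart M) (y t : M) (A : 'M[R]_n).

Definition chart_arrow_fun (u : tangent M y) : tangent M t :=
  tvec t i (tcoord u i *m A).

Lemma chart_arrow_linear : linear chart_arrow_fun.
Proof.
move=> a u v; rewrite /chart_arrow_fun tcoordDZ mulmxDl -scalemxAl.
by rewrite linearP.
Qed.

Hypotheses (iy : dom i y) (it : dom i t) (Au : A \in unitmx).

Lemma chart_arrow_bij : bijective chart_arrow_fun.
Proof.
exists (fun w => tvec y i (tcoord w i *m invmx A)) => u.
  by rewrite /chart_arrow_fun tvecK// mulmxK// tcoordK.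
by rewrite /chart_arrow_fun tvecK// mulmxKV// tcoordK.
Qed.

Definition chart_arrow : arrow y := Arrow chart_arrow_linear chart_arrow_bij.

Lemma arrow_coord_chart j k : dom j y -> dom k t ->
  arrow_coord j k chart_arrow =
  (phi k t, transition_mx j i (phi j y) *m A *m transition_mx i k (phi i t)).
Proof.
move=> jy kt; rewrite [LHS]surjective_pairing; congr (_, _).
apply: arrow_coordP => v; rewrite (tcoord_change _ it kt).
rewrite -[chart_arrow _]/(chart_arrow_fun _) /chart_arrow_fun tvecK//.
by rewrite (tcoord_change _ jy iy) tvecK// !mulmxA.
Qed.

End ChartArrow.

(** * The reflection in a chart, with affine matrices over it *)

Section Reflection.
Context {R : realType} {n : nat} {M : smooth_manifold R n}.
Variables (i : chart M) (x : M) (ix : dom i x) (L : 'I_n -> 'M[R]_n).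

Let c := phi i x.

Definition refl (z : 'rV[R]_n) : 'rV[R]_n := c + c - z.

Definition refl_mx (z : 'rV[R]_n) : 'M[R]_n :=
  - 1%:M + \sum_a (z 0 a - c 0 a) *: L a.

Let reflK z : refl (refl z) = z.
Proof. by rewrite /refl opprB addrCA subrr addr0. Qed.

Let refl_c : refl c = c.
Proof. by rewrite /refl addrK. Qed.

Let refl_dist z : `|c - refl z| = `|c - z|.
Proof.
have -> : c - refl z = - (c - z).
  by rewrite /refl !opprB addrCA opprD addNKr.
exact: normrN.
Qed.

Let refl_mx_c : refl_mx c = - 1%:M.
Proof. by rewrite /refl_mx big1 ?addr0// => a _; rewrite subrr scale0r. Qed.

Lemma Ck_refl k D : open D -> Ck k D refl.
Proof.
move=> oD; exact: (CkD oD (@Ck_cst _ k _ _ _ (c + c)) (CkN oD (@Ck_id _ k _ D))).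
Qed.

Lemma Ck_refl_mx k D : open D -> Ck k D refl_mx.
Proof.
move=> oD; apply: (CkD oD (@Ck_cst _ k _ _ _ (- 1%:M))).
apply: Ck_sum => // a; apply: CkZ => //; last exact: Ck_cst.
exact: (Ck_ext oD _ (CkD oD (Ck_coord 0 a oD (@Ck_id _ k _ D))
    (@Ck_cst _ k _ _ D (- c 0 a)))).
Qed.

Lemma is_diff_refl : is_diff c refl -%R.
Proof.
apply: is_diff_eq (is_diffD (is_diff_cst (c + c) c) (is_diffN (is_diff_id c))) _.
by apply/funext => v /=; rewrite add0r.
Qed.

Lemma is_diff_refl_mx : is_diff c refl_mx (fun v => \sum_a v 0 a *: L a).
Proof.
have lin : linear (fun v : 'rV[R]_n => \sum_a v 0 a *: L a).
  move=> a u v; rewrite scaler_sumr -big_split; apply: eq_bigr => b _ /=.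
  by rewrite !mxE scalerDl scalerA.
pose l : {linear 'rV[R]_n -> 'M[R]_n} :=
  HB.pack (fun v : 'rV[R]_n => \sum_a v 0 a *: L a)
    (GRing.isLinear.Build R _ _ _ _ lin).
have lc : continuous l by exact: mx_linear_continuous.
have Hl : is_diff c l l.
  by split; [exact: linear_differentiable|rewrite diff_lin].
have -> : refl_mx = cst (- 1%:M - l c) + l.
  apply/funext => z; rewrite /refl_mx -[RHS]/(- 1%:M - l c + l z) -addrA.
  congr (_ + _); rewrite addrC -linearB /=; apply: eq_bigr => a _.
  by rewrite !mxE.
apply: is_diff_eq (is_diffD (is_diff_cst _ c) Hl) _.
by apply/funext => v; rewrite /= add0r.
Qed.

(** A ball centred at [c] is stable under the reflection, so the base map is an involution of the
    domain and hence its own smooth inverse. Invertibility of the matrices makes them arrows. *)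
Definition refl_radius (r : R) := 0 < r /\ forall z, `|c - z| < r ->
  (phi i @` dom i) z /\ refl_mx z \in unitmx.

Lemma exists_refl_radius : exists r, refl_radius r.
Proof.
have nu : \forall z \near c, \det (refl_mx z) != 0.
  have dc : {for c, continuous (fun z => \det (refl_mx z))}.
    by apply: det_continuous; exact: (@Ck_refl_mx 0 setT openT c I).
  (* At the centre the matrix is -1, and invertibility persists nearby by continuity of the
     determinant. *)
  have d0 : \det (refl_mx c) != 0.
    rewrite refl_mx_c -unitfE -[_ \is a _]/(_ \in unitmx).
    by rewrite unitmxE -scaleN1r scalemx1 det_scalar unitrX ?unitrN ?unitr1.
  by move: dc => /cvgr_neq0; apply.
have ni : \forall z \near c, (phi i @` dom i) z.
  by apply: open_nbhs_nbhs; split; [exact: img_open|exists x].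
have /nbhs_ballP[r /= r0 rP] := nbhsI nu ni.
exists r; split=> // z zr.
have [|zu zi] := rP z; first by rewrite -ball_normE.
by split=> //; rewrite unitmxE unitfE.
Qed.

Variable r : R.
Hypothesis hr : refl_radius r.

Definition refl_dom : set M := [set y | dom i y /\ `|c - phi i y| < r].

Lemma refl_dom_near y : refl_dom y -> \forall t \near y, refl_dom t.
Proof.
move=> [iy yr]; have H : \forall z \near phi i y, `|c - z| < r.
  have H : nbhs (phi i y) (ball c r).
    apply: open_nbhs_nbhs; split; last by rewrite -ball_normE.
    by apply: ball_open; exact: hr.1.
  by apply: filterS H => z; rewrite -ball_normE.
have H' : \forall t \near y, `|c - phi i t| < r := phi_continuous iy H.
by apply: filterS2 (nbhs_dom iy) H' => t it tr; split.
Qed.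

Lemma open_refl_dom : open refl_dom.
Proof. by rewrite openE => y; exact: refl_dom_near. Qed.

Definition refl_pt (y : M) : M := psi i (refl (phi i y)).

Lemma refl_img y : refl_dom y -> (phi i @` dom i) (refl (phi i y)).
Proof.
move=> [iy yr]; by apply: (hr.2 _ _).1; rewrite refl_dist.
Qed.

Lemma phi_refl_pt y : refl_dom y -> phi i (refl_pt y) = refl (phi i y).
Proof. by move=> /refl_img; exact: psiK. Qed.

Lemma dom_refl_pt y : refl_dom y -> dom i (refl_pt y).
Proof. by move=> /refl_img[t it tE]; rewrite /refl_pt -tE phiK. Qed.

Lemma refl_dom_pt y : refl_dom y -> refl_dom (refl_pt y).
Proof.
move=> yr; split; first exact: dom_refl_pt.
by rewrite phi_refl_pt// refl_dist; case: yr.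
Qed.

Lemma refl_ptK y : refl_dom y -> refl_pt (refl_pt y) = y.
Proof.
move=> yr; rewrite {1}/refl_pt phi_refl_pt// reflK phiK//; exact: yr.1.
Qed.

Lemma refl_dom_x : refl_dom x.
Proof. by split=> //; rewrite subrr normr0; exact: hr.1. Qed.

Lemma refl_pt_x : refl_pt x = x.
Proof. by rewrite /refl_pt -/c refl_c phiK. Qed.

Definition refl_sec (y : M) : arrow y :=
  match pselect (refl_dom y) with
  | left yr => chart_arrow yr.1 (dom_refl_pt yr) (hr.2 _ yr.2).2
  | right _ => neg_arrow y
  end.

Lemma target_refl_sec y : refl_dom y -> target (refl_sec y) = refl_pt y.
Proof. by rewrite /refl_sec; case: pselect. Qed.

Lemma refl_pt_continuous y : refl_dom y -> {for y, continuous refl_pt}.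
Proof.
move=> yr; apply: (@continuous_comp _ _ _ (refl \o phi i) (psi i)).
  apply: continuous_comp; first exact: phi_continuous yr.1.
  exact: (@Ck_refl 0 setT openT _ I).
by apply: psi_continuous; exact: refl_img.
Qed.

Lemma near_target_refl_sec y : refl_dom y ->
  \forall t \near y, refl_pt t = target (refl_sec t).
Proof.
by move=> /refl_dom_near; apply: filterS => t tr; rewrite target_refl_sec.
Qed.

Lemma target_refl_sec_continuous y : refl_dom y ->
  {for y, continuous (fun t => target (refl_sec t))}.
Proof.
move=> yr; rewrite /prop_for /continuous_at target_refl_sec//.
apply: cvg_trans (refl_pt_continuous yr); apply: near_eq_cvg.
exact: near_target_refl_sec.
Qed.

Let D j k := phi j @` (refl_dom `&` dom j `&` (fun y => target (refl_sec y)) @^-1` dom k).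

Let open_D j k : open (D j k).
Proof.
rewrite /D setIAC; apply: open_chart_image; rewrite openE => y [yr ky].
apply: filterI; first exact: refl_dom_near.
exact: (target_refl_sec_continuous yr (nbhs_dom ky)).
Qed.

Let DP j k z : D j k z ->
  exists y, [/\ z = phi j y, refl_dom y, dom j y & dom k (refl_pt y)].
Proof. by move=> [y [[yr jy] ky] <-]; exists y; split=> //; rewrite -target_refl_sec. Qed.

(** The bisection is defined through the chart [i]; in other charts it acquires one Jacobian at the
    source and one at the target. Smoothness in every pair of charts is read off this product. *)
Lemma sec_coord_refl j k z : D j k z -> sec_coord j k refl_sec z =
  let w := (phi i \o psi j) z in
  ((phi k \o psi i) (refl w),
   transition_mx j i z *m refl_mx w *m transition_mx i k (refl w)).
Proof.
move=> /DP[y [-> yr jy ky]]; rewrite sec_coordE//= /refl_sec phiK//.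
case: pselect => // yr'; rewrite (arrow_coord_chart _ _ _ jy ky).
by rewrite phi_refl_pt.
Qed.

Lemma smooth_refl_sec j k : smooth_on (D j k) (sec_coord j k refl_sec).
Proof.
move=> p; have oD := @open_D j k.
have Dji z : D j k z -> (phi j @` (dom j `&` dom i)) z.
  by move=> /DP[y [-> yr jy _]]; exists y => //; split=> //; exact: yr.1.
have CT : Ck p (D j k) (phi i \o psi j) := Ck_sub Dji (transition_smooth j i p).
have CR : Ck p (D j k) (refl \o (phi i \o psi j)).
  by apply: (Ck_comp (E := setT) oD _ CT) => //; exact: Ck_refl openT.
have DR z : D j k z -> (phi i @` (dom i `&` dom k)) (refl ((phi i \o psi j) z)).
  move=> /DP[y [-> yr jy ky]]; exists (refl_pt y); last by rewrite /= phiK// phi_refl_pt.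
  by split=> //; exact: dom_refl_pt.
apply: (@Ck_ext _ _ _ _ _ (fun z => let w := (phi i \o psi j) z in
    ((phi k \o psi i) (refl w),
     transition_mx j i z *m refl_mx w *m transition_mx i k (refl w)))) => //.
  by move=> z Dz; rewrite sec_coord_refl.
apply: Ck_pair => //.
  exact: (Ck_comp oD DR CR (transition_smooth i k p)).
apply: Ck_mulmx => //; last first.
  exact: (Ck_comp oD DR CR (@smooth_transition_mx _ _ _ i k p)).
apply: Ck_mulmx => //; first exact: Ck_sub Dji (@smooth_transition_mx _ _ _ j i p).
by apply: (Ck_comp (E := setT) oD _ CT) => //; exact: Ck_refl_mx openT.
Qed.

Lemma smooth_section_refl : smooth_section_on refl_dom refl_sec.
Proof.
by split; [exact: target_refl_sec_continuous|exact: smooth_refl_sec].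
Qed.

Lemma smooth_map_refl : smooth_map_on refl_dom (fun y => target (refl_sec y)).
Proof.
split=> [|j k p]; first exact: target_refl_sec_continuous.
have := Ck_fst (@open_D j k) (@smooth_refl_sec j k p).
by [].
Qed.

Lemma image_refl_dom : (fun y => target (refl_sec y)) @` refl_dom = refl_dom.
Proof.
apply/seteqP; split=> [_ [y yr <-]|y yr].
  by rewrite /= target_refl_sec//; exact: refl_dom_pt.
exists (refl_pt y); first exact: refl_dom_pt.
by rewrite target_refl_sec ?refl_ptK//; exact: refl_dom_pt.
Qed.

Lemma diffeo_refl : diffeo_on refl_dom (fun y => target (refl_sec y)).
Proof.
split; first by rewrite image_refl_dom; exact: open_refl_dom.
  exact: smooth_map_refl.
exists (fun y => target (refl_sec y)).
  by rewrite image_refl_dom; exact: smooth_map_refl.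
move=> y yr; rewrite (target_refl_sec yr) target_refl_sec ?refl_ptK//.
exact: refl_dom_pt.
Qed.

Definition refl_bisection : bisection :=
  Bisection open_refl_dom smooth_section_refl diffeo_refl.

Lemma refl_sec_x : refl_sec x = neg_arrow x.
Proof.
apply: arrow_ext; first by rewrite target_refl_sec ?refl_pt_x//; exact: refl_dom_x.
move=> u k; have tx := target_refl_sec refl_dom_x; rewrite refl_pt_x in tx.
have [kx|nkx] := pselect (dom k x); last first.
  by rewrite tcoord_out ?tx// tcoord_out.
rewrite (arrow_coordE _ _ _ ix) [RHS](arrow_coordE _ _ _ ix); congr (_ *m _).
rewrite arrow_coord_neg// -sec_coordE// sec_coord_refl; last first.
  by exists x => //; split; [split=> //; exact: refl_dom_x|rewrite /= tx].
rewrite /= phiK// -/c refl_c refl_mx_c transition_mx_id// mul1mx.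
by rewrite mulNmx mul1mx.
Qed.

Let Dx : D i i c.
Proof.
exists x => //; split; first by split=> //; exact: refl_dom_x.
by rewrite /= target_refl_sec ?refl_pt_x//; exact: refl_dom_x.
Qed.

Let near_sec : \forall z \near c, (refl z, refl_mx z) = sec_coord i i refl_sec z.
Proof.
have : \forall z \near c, D i i z by apply: open_nbhs_nbhs; split; [exact: open_D|].
apply: filterS => z Dz; rewrite sec_coord_refl//=.
have /DP[y [-> yr iy iry]] := Dz; rewrite phiK// -phi_refl_pt// phiK//.
by rewrite !transition_mx_id// mul1mx mulmx1.
Qed.

Lemma is_diff_refl_sec : is_diff c (sec_coord i i refl_sec)
  (fun v => (- v, \sum_a v 0 a *: L a)).
Proof.
apply: (near_is_diff near_sec).
exact: (is_diff_pair is_diff_refl is_diff_refl_mx).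
Qed.

Lemma base_diff_refl (bx : bdom refl_bisection x) :
  base_diff bx = neg_arrow x.
Proof.
have bE : base refl_bisection x = x.
  by rewrite /base /= target_refl_sec ?refl_pt_x//; exact: refl_dom_x.
have [_ sb _] := bsec_diffeo refl_bisection.
apply: arrow_ext; first exact: bE.
move=> u k; have [kx|nkx] := pselect (dom k x); last first.
  by rewrite tcoord_out ?[target _]bE// tcoord_out.
have ibx : dom i (base refl_bisection x) by rewrite bE.
have kbx : dom k (base refl_bisection x) by rewrite bE.
rewrite (tcoord_change _ ibx kbx) [RHS](tcoord_change _ ix kx).
apply: (congr2 mulmx); last exact: (congr1 (fun y => transition_mx i k (phi i y)) bE).
rewrite -[LHS]/(tcoord (tangent_map (base refl_bisection) u) i).
rewrite (tcoord_tangent_map _ open_refl_dom sb bx ix ibx).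
apply: etrans (diff_base bx ix ibx _) _.
exact: (congr1 fst (is_diff_pt _ is_diff_refl_sec)).
Qed.

End Reflection.

Lemma exists_symmetry_bisection (R : realType) n (M : smooth_manifold R n)
    (i : chart M) x (L : 'I_n -> 'M[R]_n) : dom i x ->
  exists b : bisection_at x, [/\ sval b x = neg_arrow x,
    base_diff (svalP b) = neg_arrow x &
    forall v, ('d (sec_coord i i (sval b)) (phi i x) v).2 = \sum_a v 0 a *: L a].
Proof.
move=> ix; have [r hr] := exists_refl_radius ix L.
exists (exist _ (refl_bisection hr) (refl_dom_x ix hr)); split=> /=.
- exact: refl_sec_x.
- exact: base_diff_refl.
- by move=> v; exact: (congr1 snd (is_diff_pt v (is_diff_refl_sec ix hr))).
Qed.

(** * The correspondence *)

(** Needed for differentials evaluated on a vector field: the direction moves with the point, and is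
    expanded in the standard basis. *)
Lemma Ck_linear_app (R : realType) (V W : normedModType R) n k (D : set V)
    (F : V -> {linear 'rV[R]_n -> W}) (w : V -> 'rV[R]_n) : open D ->
  (forall v, Ck k D (fun z => F z v)) -> Ck k D w -> Ck k D (fun z => F z (w z)).
Proof.
move=> oD CF Cw.
apply: (@Ck_ext _ _ _ _ _ (fun z => \sum_a w z 0 a *: F z (delta_mx 0 a))) => //.
  move=> z _; rewrite [in RHS](row_sum_delta (w z)) linear_sum.
  by apply: eq_bigr => a _; rewrite linearZ.
by apply: Ck_sum => // a; apply: CkZ => //; exact: Ck_coord.
Qed.

Section ConnectionFormula.
Context {R : realType} {n : nat}.
Implicit Types (F : {linear 'rV[R]_n -> 'rV[R]_n})
  (G : {linear 'rV[R]_n -> ('rV[R]_n * 'M[R]_n)%type}) (u v : 'rV[R]_n).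

(** The half bracket in a chart: [F] stands for dY, [G] for the differential of the bisection, [u]
    and [v] for the coordinates of X and Y at the point. In this form the connection axioms become
    linear algebra. *)
Definition conn_formula F G u v := F u - 2%:R^-1 *: (v *m (G u).2).

Lemma conn_formula_linear F G v a u u' :
  conn_formula F G (a *: u + u') v = a *: conn_formula F G u v + conn_formula F G u' v.
Proof.
rewrite /conn_formula (linearP F) (linearP G) /= mulmxDr -scalemxAr scalerDr opprD.
by rewrite scalerBr scalerA [2^-1 * a]mulrC -scalerA addrACA.
Qed.

Lemma conn_formulaZl F G v a u :
  conn_formula F G (a *: u) v = a *: conn_formula F G u v.
Proof.
rewrite /conn_formula (linearZZ F) (linearZZ G) /= -scalemxAr scalerBr !scalerA.
by rewrite mulrC.
Qed.

Lemma conn_formulaD F F' F'' G u v v' : F'' u = F u + F' u ->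
  conn_formula F'' G u (v + v') = conn_formula F G u v + conn_formula F' G u v'.
Proof.
by rewrite /conn_formula => ->; rewrite mulmxDl scalerDr opprD addrACA.
Qed.

Lemma conn_formulaZ F F'' G u v (a d : R) : F'' u = a *: F u + d *: v ->
  conn_formula F'' G u (a *: v) = a *: conn_formula F G u v + d *: v.
Proof.
rewrite /conn_formula => ->; rewrite -scalemxAl scalerBr !scalerA.
by rewrite [2^-1 * a]mulrC addrAC.
Qed.

(** With [w] the Christoffel term, this is where the factor -2 between dA and the Christoffel
    symbols comes from. *)
Lemma conn_formulaP F G u v w :
  conn_formula F G u v = F u + w <-> v *m (G u).2 = - 2%:R *: w.
Proof.
have n2 : (2 : R) != 0 by rewrite pnatr_eq0.
rewrite /conn_formula; split=> [/addrI <-|->].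
  by rewrite scalerN scaleNr opprK scalerA divff// scale1r.
by rewrite scalerA mulrN mulVf// scaleN1r opprK.
Qed.

End ConnectionFormula.

Section Jets.
Context {R : realType} {n : nat} {M : smooth_manifold R n}.
Implicit Types (i j : chart M) (x y : M) (X Y : vfield M).

Lemma tcoord_jet_half_bracket x (eta : jet x) X Y i :
  jet_p eta = neg_arrow x -> jet_pstar eta = neg_arrow x -> dom i x ->
  tcoord (2%:R^-1 *: bracket X (fun y => Y y + push (jet_repr eta) Y y) x) i =
  conn_formula ('d (vcoord Y i) (phi i x))
    ('d (sec_coord i i (jet_repr eta)) (phi i x)) (tcoord (X x) i) (tcoord (Y x) i).
Proof. by move=> ep es; exact: (tcoord_half_bracket (bx := svalP (repr eta))). Qed.

Lemma symmetry_jet_ext (s s' : symmetry_jet M) : (forall x, s x = s' x) -> s = s'.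
Proof.
case: s s' => [s h1 h2 h3 h4] [s' h1' h2' h3' h4'] /= ss.
have E : s = s' by apply: functional_extensionality_dep.
by subst s'; congr SymmetryJet; exact: Prop_irrelevance.
Qed.

(** Fields X with value [v] at [x] and Y with a basis row as value there test [B v] row by row. *)
Lemma eq_mx_vfields i x (B B' : 'rV[R]_n -> 'M[R]_n) : dom i x ->
  (forall X Y, tcoord (Y x) i *m B (tcoord (X x) i) =
               tcoord (Y x) i *m B' (tcoord (X x) i)) -> B =1 B'.
Proof.
move=> ix BB v; apply/row_matrixP => a; rewrite !rowE.
have [X Xx] := exists_vfield v ix; have [Y Yx] := exists_vfield (delta_mx 0 a) ix.
by have := BB X Y; rewrite (nbhs_singleton Xx) (nbhs_singleton Yx).
Qed.

(** * From a symmetry jet to a connection *)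

Section JetToConnection.
Variable s : symmetry_jet M.

(** Computed with the representative selected by the quotient; [jet_connection_eq] shows that every
    other representative gives the same vector. *)
Definition jet_cov X Y x : tangent M x :=
  2%:R^-1 *: bracket X (fun y => Y y + push (jet_repr (s x)) Y y) x.

Lemma tcoord_jet_cov X Y x i : dom i x -> tcoord (jet_cov X Y x) i =
  conn_formula ('d (vcoord Y i) (phi i x))
    ('d (sec_coord i i (jet_repr (s x))) (phi i x)) (tcoord (X x) i) (tcoord (Y x) i).
Proof. exact: (tcoord_jet_half_bracket X Y (sj_p s x) (sj_pstar s x)). Qed.

Lemma target_jet_p x : target (jet_p (s x)) = x.
Proof. by rewrite sj_p. Qed.

(** By [tcoord_jet_cov] the bracket at every point of [dom i] can be computed in the one chart [i];
    the differential occurring there is a quantity whose smoothness [smooth_jets] asserts. *)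
Lemma smooth_jet_cov X Y i :
  smooth_on (phi i @` dom i) (fun z => tcoord (jet_cov X Y (psi i z)) i).
Proof.
move=> k; have oD := @img_open _ _ M i.
apply: (@Ck_ext _ _ _ _ _ (fun z => conn_formula ('d (vcoord Y i) z)
  ('d (sec_coord i i (jet_repr (s (psi i z)))) z) (vcoord X i z) (vcoord Y i z))) => //.
  by move=> _ [x ix <-]; rewrite (phiK ix) tcoord_jet_cov// !vcoordE.
apply: CkD => //.
  apply: Ck_linear_app => //; last exact: smooth_vcoord.
  by have [_ +] := @smooth_vcoord _ _ _ Y i k.+1; exact.
apply: CkN => //; apply: CkZ => //; first exact: Ck_cst.
apply: Ck_mulmx => //; first exact: smooth_vcoord.
apply: Ck_snd => //; apply: Ck_linear_app => //; last exact: smooth_vcoord.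
move=> v; have [_ /(_ i i)[_ /(_ v k)]] := sj_smooth s.
apply: Ck_sub => _ [x ix <-]; exists x => //; split=> //.
(* The base map of the jets is the identity, so the domain in [smooth_jets] for the pair (i, i) is
   the whole image of [dom i]. *)
by rewrite /preimage /= target_jet_p.
Qed.

Definition jet_cov_vfield X Y : vfield M := VField (smooth_jet_cov X Y).

Lemma jet_covP X Y x i (u : tangent M x) : dom i x ->
  conn_formula ('d (vcoord Y i) (phi i x))
    ('d (sec_coord i i (jet_repr (s x))) (phi i x)) (tcoord (X x) i) (tcoord (Y x) i)
    = tcoord u i -> jet_cov X Y x = u.
Proof.
move=> ix E; apply: (tangent_ext ix); apply: etrans E; exact: tcoord_jet_cov.
Qed.

Lemma jet_covDl X X' Y :
  jet_cov_vfield (vadd X X') Y = vadd (jet_cov_vfield X Y) (jet_cov_vfield X' Y).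
Proof.
apply: vfield_ext => x; have ix := chart_atP x; apply: (jet_covP ix).
rewrite tcoordD -[in LHS](scale1r (X x)).
apply: etrans (conn_formula_linear _ _ _ _ _ _) _; rewrite scale1r.
by congr (_ + _); apply/esym; exact: tcoord_jet_cov.
Qed.

Lemma jet_covZl f X Y : jet_cov_vfield (vscale f X) Y = vscale f (jet_cov_vfield X Y).
Proof.
apply: vfield_ext => x; have ix := chart_atP x; apply: (jet_covP ix).
apply: etrans (conn_formulaZl _ _ _ _ _) _.
by congr (_ *: _); apply/esym; exact: tcoord_jet_cov.
Qed.

Lemma jet_covDr X Y Y' :
  jet_cov_vfield X (vadd Y Y') = vadd (jet_cov_vfield X Y) (jet_cov_vfield X Y').
Proof.
apply: vfield_ext => x; have ix := chart_atP x; apply: (jet_covP ix).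
apply: etrans (conn_formulaD _ _ _ _) _; last first.
  by rewrite tcoordD; congr (_ + _); apply/esym; exact: tcoord_jet_cov.
have dY Z := differentiableP (vcoord_differentiable Z ix).
exact: (is_diff_pt _ (is_diffD (dY Y) (dY Y'))).
Qed.

Lemma jet_covZr f X Y x : jet_cov_vfield X (vscale f Y) x =
  f x *: jet_cov_vfield X Y x + dir_deriv f (X x) *: Y x.
Proof.
have ix := chart_atP x; apply: (jet_covP ix).
rewrite tcoordD !tcoordZ (dir_derivE _ _ ix).
have E := esym (tcoord_jet_cov X Y ix).
apply: etrans _ (congr1 (fun w => f x *: w + _) E).
apply: conn_formulaZ.
have df : differentiable (f \o psi (chart_at x)) (phi (chart_at x) x).
  by have [+ _] := sfunP f (chart_at x) 1%N; apply; exists x.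
apply: etrans (is_diff_pt _ (is_diff_scale df (vcoord_differentiable Y ix))) _.
by rewrite /= phiK// vcoordE.
Qed.

Definition jet_connection : affine_connection M :=
  AffineConnection jet_covDl jet_covZl jet_covDr jet_covZr.

End JetToConnection.

(** The half bracket sees a bisection only through its first differential at [x], which is part of
    the jet. *)
Lemma jet_connection_eq (s : symmetry_jet M) X Y x (b : bisection_at x) : s x = jet1 b ->
  jet_connection s X Y x =
    2%:R^-1 *: bracket X (fun y => Y y + push (sval b) Y y) x.
Proof.
move=> sx; have ix := chart_atP x.
have bp : sval b x = neg_arrow x by rewrite -jet_p1 -sx sj_p.
have bs : base_diff (svalP b) = neg_arrow x by rewrite -jet_pstar1 -sx sj_pstar.
have [e d] : same_jet (repr (s x)) b by rewrite sx; exact: same_jet_repr.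
have jx : dom (chart_at x) (base (jet_repr (s x)) x).
  by rewrite /base -[jet_repr _ x]/(jet_p (s x)) target_jet_p.
apply: (jet_covP ix); apply: etrans (esym (tcoord_half_bracket bp bs X Y ix)).
exact: (congr1 (fun h : 'rV[R]_n -> 'rV[R]_n * 'M[R]_n =>
  'd (vcoord Y (chart_at x)) (phi (chart_at x) x) (tcoord (X x) (chart_at x)) -
  2%:R^-1 *: (tcoord (Y x) (chart_at x) *m (h (tcoord (X x) (chart_at x))).2))
  (d _ _ ix jx)).
Qed.

Lemma jet_connection_inj : injective (@jet_connection).
Proof.
move=> s s' ss; apply: symmetry_jet_ext => x.
rewrite -[LHS]reprK -[RHS]reprK; apply/jet1P.
have bp := sj_p s x; have bp' := sj_p s' x.
split=> [|i j ix jx]; first exact: etrans bp (esym bp').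
have {}jx : dom j x by rewrite -(target_jet_p s x); exact: jx.
have E : (fun v => ('d (sec_coord i i (jet_repr (s x))) (phi i x) v).2) =1
         (fun v => ('d (sec_coord i i (jet_repr (s' x))) (phi i x) v).2).
  apply: (eq_mx_vfields ix) => X Y.
  have e := congr1 (fun N : affine_connection M => tcoord (N X Y x) i) ss.
  have := etrans (esym (tcoord_jet_cov s X Y ix)) (etrans e (tcoord_jet_cov s' X Y ix)).
  move=> /addrI /oppr_inj /scalerI; apply.
  by rewrite invr_neq0// pnatr_eq0.
(* By [diff_sec_coord], the differential in the pair (i, j) is the same function of the matrix part
   for (i, i) in both jets. *)
apply/funext => v.
apply: etrans (diff_sec_coord bp (sj_pstar s x) v ix jx) _.
apply: etrans (esym (diff_sec_coord bp' (sj_pstar s' x) v ix jx)).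
exact: (congr1 (fun B => (- (v *m transition_mx i j (phi i x)),
  B *m transition_mx i j (phi i x) +
  'd (transition_mx i j : _ -> 'M[R]_n) (phi i x) v)) (E v)).
Qed.

(** * From a connection to a symmetry jet *)

Section ConnectionToJet.
Variable N : affine_connection M.

Definition christoffel i : 'I_n -> 'rV[R]_n -> 'M[R]_n :=
  projT1 (cid (exists_christoffel N i)).

Lemma smooth_christoffel i a : smooth_on (phi i @` dom i) (christoffel i a).
Proof. exact: (projT2 (cid (exists_christoffel N i))).1. Qed.

Lemma tcoord_cov X Y x i : dom i x ->
  tcoord (N X Y x) i = 'd (vcoord Y i) (phi i x) (tcoord (X x) i) +
    tcoord (Y x) i *m \sum_a tcoord (X x) i 0 a *: christoffel i a (phi i x).
Proof. exact: (projT2 (cid (exists_christoffel N i))).2. Qed.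

(** The derivative is prescribed in [chart_at x] only, with the factor -2 of [conn_formulaP];
    [conn_jet_diff] supplies the other charts. *)
Definition conn_bisection x : bisection_at x := projT1 (cid
  (exists_symmetry_bisection
    (fun a => - 2%:R *: christoffel (chart_at x) a (phi (chart_at x) x)) (chart_atP x))).

Lemma conn_bisectionP x : [/\ sval (conn_bisection x) x = neg_arrow x,
  base_diff (svalP (conn_bisection x)) = neg_arrow x &
  forall v, ('d (sec_coord (chart_at x) (chart_at x) (sval (conn_bisection x)))
      (phi (chart_at x) x) v).2 =
    \sum_a v 0 a *: (- 2%:R *: christoffel (chart_at x) a (phi (chart_at x) x))].
Proof. exact: (projT2 (cid (exists_symmetry_bisection _ (chart_atP x)))). Qed.

Definition conn_jet x : jet x := jet1 (conn_bisection x).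

Lemma conn_jet_p x : jet_p (conn_jet x) = neg_arrow x.
Proof. by rewrite jet_p1; have [] := conn_bisectionP x. Qed.

Lemma conn_jet_pstar x : jet_pstar (conn_jet x) = neg_arrow x.
Proof. by rewrite jet_pstar1; have [] := conn_bisectionP x. Qed.

Lemma conn_jet_half_bracket X Y x :
  2%:R^-1 *: bracket X (fun y => Y y + push (jet_repr (conn_jet x)) Y y) x = N X Y x.
Proof.
have ix := chart_atP x; have [_ _ HL] := conn_bisectionP x.
apply: (tangent_ext ix).
apply: etrans (tcoord_jet_half_bracket X Y (conn_jet_p x) (conn_jet_pstar x) ix) _.
apply: etrans (esym (tcoord_cov X Y ix)); apply/conn_formulaP.
have [e d] := same_jet_repr (conn_bisection x).
have jx : dom (chart_at x) (base (jet_repr (conn_jet x)) x).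
  by rewrite /base -[jet_repr _ x]/(jet_p (conn_jet x)) conn_jet_p.
apply: etrans (esym (scalemxAr _ _ _)); apply: (congr1 (mulmx _)).
apply: etrans (congr1 (fun h => (h _).2) (d _ _ ix jx)) _.
rewrite HL scaler_sumr; apply: eq_bigr => a _.
by rewrite !scalerA mulrC.
Qed.

(** The half bracket of the jet and the connection agree as tangent vectors; comparing their
    coordinates in [i] for all X and Y isolates the differential in that chart. *)
Lemma conn_jet_diff x i v : dom i x ->
  ('d (sec_coord i i (jet_repr (conn_jet x))) (phi i x) v).2 =
  - 2%:R *: \sum_a v 0 a *: christoffel i a (phi i x).
Proof.
move=> ix; move: v; apply: (eq_mx_vfields
  (B := fun v => ('d (sec_coord i i (jet_repr (conn_jet x))) (phi i x) v).2)
  (B' := fun v => - 2%:R *: \sum_a v 0 a *: christoffel i a (phi i x)) ix) => X Y.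
have := tcoord_jet_half_bracket X Y (conn_jet_p x) (conn_jet_pstar x) ix.
rewrite conn_jet_half_bracket => e.
have /conn_formulaP E := etrans (esym e) (tcoord_cov X Y ix).
exact: etrans E (scalemxAr _ _ _).
Qed.

Lemma smooth_conn_jet : smooth_jets conn_jet.
Proof.
have yE : (fun x => target (jet_p (conn_jet x))) = id.
  by apply/funext => x; rewrite conn_jet_p.
split; first by rewrite yE => x; exact: cvg_id.
move=> i j D; have -> : D = phi i @` (dom i `&` dom j).
  by rewrite /D yE.
have oD := @open_overlap _ _ M i j.
have Di : phi i @` (dom i `&` dom j) `<=` phi i @` dom i.
  by move=> _ [x [ix _] <-]; exists x.
split=> [k|v k].
  apply: (@Ck_ext _ _ _ _ _
      (fun z => ((phi j \o psi i) z, - transition_mx i j z))) => //.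
    move=> _ [x [ix jx] <-]; rewrite (phiK ix).
    rewrite (sec_coord_neg (conn_jet_p x) ix jx) /=.
    by rewrite phiK.
  apply: Ck_pair => //; first exact: transition_smooth.
  by apply: CkN => //; exact: smooth_transition_mx.
(* The jet at each point has its own representative, but the differentials are given by one formula
   in the Christoffel symbols of the fixed chart [i]. *)
apply: (@Ck_ext _ _ _ _ _ (fun z => (- (v *m transition_mx i j z),
    (- 2%:R *: \sum_a v 0 a *: christoffel i a z) *m transition_mx i j z +
    'd (transition_mx i j : _ -> 'M[R]_n) z v))) => //.
  move=> _ [x [ix jx] <-]; rewrite (phiK ix).
  apply: etrans _ (esym (diff_sec_coord (conn_jet_p x) (conn_jet_pstar x) v ix jx)).
  exact: (congr1 (fun B => (- (v *m transition_mx i j (phi i x)),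
    B *m transition_mx i j (phi i x) +
    'd (transition_mx i j : _ -> 'M[R]_n) (phi i x) v)) (esym (conn_jet_diff v ix))).
have CT : Ck k (phi i @` (dom i `&` dom j)) (transition_mx i j).
  exact: smooth_transition_mx.
apply: Ck_pair => //.
  by apply: CkN => //; apply: Ck_mulmx => //; exact: Ck_cst.
apply: CkD => //; last by have [_ +] := @smooth_transition_mx _ _ _ i j k.+1; exact.
apply: Ck_mulmx => //; apply: CkZ => //; first exact: Ck_cst.
apply: Ck_sum => // a; apply: CkZ => //; first exact: Ck_cst.
exact: Ck_sub Di (@smooth_christoffel i a k).
Qed.

Lemma conn_jet_semi_holonomic x : semi_holonomic (conn_jet x).
Proof. by rewrite /semi_holonomic conn_jet_p conn_jet_pstar. Qed.

Definition conn_symmetry_jet : symmetry_jet M :=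
  SymmetryJet conn_jet_semi_holonomic smooth_conn_jet conn_jet_p conn_jet_pstar.

Lemma conn_symmetry_jetK : jet_connection conn_symmetry_jet = N.
Proof. by apply: affine_connection_ext => X Y x; exact: conn_jet_half_bracket. Qed.

End ConnectionToJet.

End Jets.

Theorem proposition2p2 (R : realType) (n : nat) (M : smooth_manifold R n) :
  exists nabla : symmetry_jet M -> affine_connection M,
    (forall (s : symmetry_jet M) (X Y : vfield M) (x : M)
       (b : bisection_at x),
       s x = jet1 b ->
       nabla s X Y x =
         2%:R^-1 *: bracket X (fun y => Y y + push (sval b) Y y) x) /\
    bijective nabla.
Proof.
exists (@jet_connection R n M); split; first exact: jet_connection_eq.
exists (@conn_symmetry_jet R n M); last exact: conn_symmetry_jetK.
(* A right inverse of an injective map is also a left inverse. *)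
by move=> s; apply: jet_connection_inj; exact: conn_symmetry_jetK.
Qed.
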